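(* The following hold: (a) $\mathcal{J}\subset\mathcal{OS}$; (b) $\mathcal{J}\cap\mathcal{L}=\mathcal{S}$; (b$'$) $\mathcal{J}\cap\mathcal{L}(\gamma)=\mathcal{S}(\gamma)$ for every $\gamma>0$; (c) $\mathcal{D}\subset\mathcal{J}$; (d) $\mathcal{J}\nsubseteq\mathcal{K}$.
   Context: Let $\mathcal{F}$ be the set of all distribution functions of nonnegative random variables with unbounded support. For $F\in\mathcal{F}$ write $\overline{F}=1-F$, and let $F^{n*}$ be the $n$-fold convolution of $F$ with itself. The symbol $\subset$ denotes (not necessarily strict) inclusion. The class $\mathcal{J}$ is the set of all $F\in\mathcal{F}$ such that, for $X_1,X_2,\ldots$ i.i.d. with distribution function $F$ and for all $n\ge2$, $$\lim_{K\to\infty}\liminf_{x\to\infty}\frac{\mathbb{P}(\max(X_1,\ldots,X_n)>x-K,\;X_1+\cdots+X_n>x)}{\mathbb{P}(X_1+\cdots+X_n>x)}=1.$$ The following are classes of $F\in\mathcal{F}$: - $\mathcal{K}$ (heavy-tailed): $\int_0^\infty e^{\lambda x}\,dF(x)=\infty$ for all $\lambda>0$. - $\mathcal{S}$ (subexponential): $\lim_{x\to\infty}\overline{F^{n*}}(x)/\overline{F}(x)=n$ for all $n\ge2$. - $\mathcal{L}$ (long-tailed): $\lim_{x\to\infty}\overline{F}(x+y)/\overline{F}(x)=1$ for every $y\in\mathbb{R}\setminus\{0\}$. - $\mathcal{D}$ (dominatedly varying): $\limsup_{x\to\infty}\overline{F}(xu)/\overline{F}(x)<\infty$ for all (equivalently,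 some) $0<u<1$. - $\mathcal{OS}$: $\limsup_{x\to\infty}\overline{F^{2*}}(x)/\overline{F}(x)<\infty$. - $\mathcal{L}(\gamma)$, $\gamma\ge0$: $\lim_{x\to\infty}\overline{F}(x+y)/\overline{F}(x)=e^{-\gamma y}$ for every $y\in\mathbb{R}$. - $\mathcal{S}(\gamma)$, $\gamma\ge0$: $F\in\mathcal{L}(\gamma)$ and, for some constant $c\in(0,\infty)$, $\lim_{x\to\infty}\overline{F^{2*}}(x)/\overline{F}(x)=2c$. *)

(* Defs.v *)
From HB Require Import structures.
From mathcomp Require Import all_boot all_order all_algebra.
From mathcomp Require Import all_classical all_reals all_analysis.

Set Implicit Arguments.
Unset Strict Implicit.
Unset Printing Implicit Defensive.

Import Order.TTheory GRing.Theory Num.Theory.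
Import numFieldNormedType.Exports.

Local Open Scope classical_set_scope.
Local Open Scope ring_scope.

(* Right-continuous nondecreasing functions with limits 0 at -oo and 1 at +oo. *)
Notation df R := (cumulativeBounded (0 : R) (1 : R)).

Section distribution_functions.
Context {R : realType}.
Implicit Types (F : df R) (G : R -> R).

Definition tail G (x : R) : R := 1 - G x.

Definition convolution G F (x : R) : R :=
  \int[lebesgue_stieltjes_measure F]_y G (x - y).

(* The 0-fold convolution is the distribution function of the point mass at 0,
   the neutral element of convolution. *)
Fixpoint nconv F (n : nat) : R -> R :=
  if n is m.+1 then convolution (nconv F m) F else fun x => (0 <= x)%R%:R.

End distribution_functions.

Section iid.
Context {d : measure_display} {T : measurableType d} {R : realType}.
Variables (P : probability T R) (n : nat).
Implicit Type X : 'I_n -> {RV P >-> R}.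

Definition mutually_independent X :=
  forall (J : {set 'I_n}) (B : 'I_n -> set R),
    (forall i, measurable (B i)) ->
    fine (P (\bigcap_(i in [set` J]) X i @^-1` B i)) =
    \prod_(i in J) fine (P (X i @^-1` B i)).

Definition iid X (F : df R) :=
  (forall i x, cdf (X i) x = (F x)%:E) /\ mutually_independent X.

Definition rv_sum X (t : T) : R := \sum_(i < n) X i t.

(* Extended-real valued only so that -oo can serve as the empty maximum. *)
Definition rv_max X (t : T) : \bar R := \big[maxe/-oo%E]_(i < n) (X i t)%:E.

Definition big_jump_ratio X (K x : R) : R :=
  fine (P [set t | ((x - K)%:E < rv_max X t)%E /\ x < rv_sum X t]) /
  fine (P [set t | x < rv_sum X t]).

End iid.

Section classes.
Context (R : realType).

(* [F x < 1] for all [x]: the support is unbounded (above). *)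
Definition classF : set (df R) :=
  [set F | (forall x, x < 0 -> F x = 0) /\ (forall x, F x < 1)].

(* The ratio depends only on the joint law of X_1, ..., X_n, hence it does not
   matter on which probability space the X_i are defined. *)
Definition classJ : set (df R) :=
  [set F | classF F /\
    forall n : nat, (2 <= n)%N ->
    forall (d : measure_display) (T : measurableType d) (P : probability T R)
      (X : 'I_n -> {RV P >-> R}), iid X F ->
    limf_einf (fun x : R => (big_jump_ratio X K x)%:E) +oo%R
      @[K --> +oo%R] --> 1%E].

Definition classK : set (df R) :=
  [set F | classF F /\
    forall lambda : R, 0 < lambda ->
    (\int[lebesgue_stieltjes_measure F]_(x in `[0%R, +oo[)
       (expR (lambda * x))%:E = +oo)%E].

Definition classS : set (df R) :=
  [set F | classF F /\
    forall n : nat, (2 <= n)%N ->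
    tail (nconv F n) x / tail F x @[x --> +oo] --> (n%:R : R)].

Definition classL : set (df R) :=
  [set F | classF F /\
    forall y : R, y != 0 -> tail F (x + y) / tail F x @[x --> +oo] --> (1 : R)].

Definition classD : set (df R) :=
  [set F | classF F /\
    forall u : R, 0 < u < 1 ->
    (limf_esup (fun x : R => (tail F (x * u) / tail F x)%:E) +oo%R < +oo)%E].

Definition classOS : set (df R) :=
  [set F | classF F /\
    (limf_esup (fun x : R => (tail (nconv F 2) x / tail F x)%:E) +oo%R
       < +oo)%E].

(* [classLg gamma] and [classSg gamma] are meant for [0 <= gamma]. *)
Definition classLg (gamma : R) : set (df R) :=
  [set F | classF F /\
    forall y : R,
    tail F (x + y) / tail F x @[x --> +oo] --> expR (- gamma * y)].

Definition classSg (gamma : R) : set (df R) :=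
  [set F | classLg gamma F /\
    exists2 c : R, 0 < c &
    tail (nconv F 2) x / tail F x @[x --> +oo] --> 2 * c].

End classes.

Arguments classF R : clear implicits.
Arguments classJ R : clear implicits.
Arguments classK R : clear implicits.
Arguments classS R : clear implicits.
Arguments classL R : clear implicits.
Arguments classD R : clear implicits.
Arguments classOS R : clear implicits.

(* Main.v *)
Require Import Defs.
From HB Require Import structures.
From mathcomp Require Import all_boot all_order all_algebra.
From mathcomp Require Import all_classical all_reals all_analysis.
From mathcomp Require Import measurable_realfun ring lra.

(** Write [T] for the tail of [F] and let [X], [Y] be independent with law [F]. Everything
    goes through one condition on two summands ([single_jump]): for every [e > 0] there
    is [K] such that, for large [x], the probability that [X + Y > x] although [X] and
    [Y] are at most [x - K] is at most [e T(x)].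

    This condition characterizes J. The rectangle of the pairs [(u, v)] with
    [x - M < u <= x - K] and [v > M] is contained in the exceptional event; comparing
    masses gives that [T(x - 1) / T(x)] is bounded, hence that the tail of [X + Y] is
    [O(T)], which is membership in OS. So it does not matter whether the exceptional
    event is measured against the tail of the sum or against [T], and J for two
    summands implies the condition ([classJ_single_jump]). Conversely, the condition
    passes to [n] summands by induction ([partial_sum_no_jump]): the partial sum has a
    tail [O(T)], so it competes with the next summand essentially like a single
    variable, unless it already exceeds [x - M] without a jump.

    If [F] is long-tailed, a jump beyond [x - K] is as likely as a jump beyond [x], so
    the condition says that the tail of [X + Y] is equivalent to [2 T]; the case of
    more summands follows by convolving asymptotic bounds ([nconv_ratio_cvg]). If [F]
    is dominatedly varying, a sum without a jump has one summand above [x / 2] and the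
    other one above [K], which has probability at most [2 T(K) T(x / 2) = O(T(K) T(x))].

    In L(g), dominated convergence shows that the part of [P(X + Y > x) / T(x)] with a
    jump beyond [x - K] tends to twice [m_K = E exp (g min (X, K))]
    ([nconv2_no_jump_ratio]). Under the condition the whole ratio is therefore Cauchy,
    which gives S(g). For the converse one has to know that the constant [c] of S(g)
    is the supremum [m] of the [m_K]. It is at least [m]; that it is at most [m] is
    proved by an argument in the spirit of Foss and Korshunov ([lower_limit_le]). For
    [l] slightly larger than [g] consider [exp (l min (s, t)) - exp (g min (s, t))],
    with [t] chosen such that its mean over [X] is a small number [e]: such [t] exist,
    because exponential moments of order [l] are infinite. Since [min (s, t)] is
    subadditive, its mean over [X + Y] is at most about [(m + e)^2 - m^2], while
    comparing tails bounds it below by about [2 c e]. Letting [e] tend to 0 yields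
    [c <= m].

    Finally the law with tail [2 exp (- x) / ((1 + x) (2 + x))] satisfies the condition,
    because its exponential moment of order 1 converges and the polynomial factor is
    dominatedly varying; it is light-tailed. *)

Set Implicit Arguments.
Unset Strict Implicit.
Unset Printing Implicit Defensive.

Import Order.TTheory GRing.Theory Num.Theory.
Import numFieldNormedType.Exports.

Local Open Scope classical_set_scope.
Local Open Scope ring_scope.

(** * Real-valued probabilities and expectations *)

Section probability_calculus.
Context d (T : measurableType d) (R : realType) (P : probability T R).
Implicit Types (A B C : set T) (f g : T -> R).

Definition pr A : R := fine (P A).

Definition bounded_measurable f :=
  measurable_fun setT f /\ exists M, forall t, `|f t| <= M.

Lemma prE A : measurable A -> (pr A)%:E = P A.
Proof. by move=> mA; rewrite /pr fineK// fin_num_measure. Qed.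

Lemma pr_ge0 A : 0 <= pr A.
Proof. by rewrite /pr fine_ge0. Qed.

Lemma pr_le A B : measurable A -> measurable B -> A `<=` B -> pr A <= pr B.
Proof.
by move=> mA mB AB; rewrite -lee_fin !prE// le_measure// inE.
Qed.

Lemma prT : pr setT = 1.
Proof. by rewrite /pr probability_setT. Qed.

Lemma pr0 : pr set0 = 0.
Proof. by rewrite /pr measure0. Qed.

Lemma pr_le1 A : measurable A -> pr A <= 1.
Proof. by move=> mA; rewrite -prT; exact: pr_le. Qed.

Lemma prU A B : measurable A -> measurable B -> A `&` B = set0 ->
  pr (A `|` B) = pr A + pr B.
Proof.
move=> mA mB AB; apply: EFin_inj; rewrite EFinD !prE//; last exact: measurableU.
by rewrite measureU.
Qed.

Lemma pr_setID B A : measurable A -> measurable B ->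
  pr A = pr (A `&` B) + pr (A `&` ~` B).
Proof.
move=> mA mB; have mBc := measurableC mB.
rewrite -prU; [|exact: measurableI|exact: measurableI|].
- by rewrite -setIUr setUv setIT.
- by rewrite setIACA setICr setI0.
Qed.

Lemma pr_setC A : measurable A -> pr (~` A) = 1 - pr A.
Proof.
move=> mA; have := pr_setID measurableT mA.
by rewrite prT !setTI => ->; rewrite addrAC subrr add0r.
Qed.

Lemma prU2 A B : measurable A -> measurable B ->
  pr (A `|` B) = pr A + pr B - pr (A `&` B).
Proof.
move=> mA mB; have mBc := measurableC mB.
rewrite (pr_setID _ mB)//; last exact: measurableU.
rewrite (pr_setID mA mB).
rewrite setIC setKU [in X in _ + X](_ : _ `&` _ = A `&` ~` B).
  lra.
by rewrite setIUl setICr setU0.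
Qed.

Lemma pr_leD A B C : measurable A -> measurable B -> measurable C ->
  A `<=` B `|` C -> pr A <= pr B + pr C.
Proof.
move=> mA mB mC ABC.
have : pr A <= pr (B `|` C) by apply: pr_le => //; exact: measurableU.
by rewrite prU2//; have := pr_ge0 (B `&` C); lra.
Qed.

Lemma bmfP f : bounded_measurable f -> P.-integrable setT (EFin \o f).
Proof.
move=> [mf [M fM]]; apply: measurable_bounded_integrable => //.
- by rewrite [ltLHS](probability_setT P) ltry.
- exists M; split; first exact: num_real.
  by move=> x Mx t _; exact: le_trans (fM t) (ltW Mx).
Qed.

Lemma bmf_cst c : bounded_measurable (fun=> c).
Proof. by split; [exact: measurable_cst|exists `|c|]. Qed.

Lemma bmf_indic A : measurable A -> bounded_measurable \1_A.
Proof.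
move=> mA; split; first exact: measurable_indic.
by exists 1 => t; rewrite indicE; case: (_ \in _); rewrite ?normr1 ?normr0.
Qed.

Lemma indic_set (p : pred T) t : \1_[set s | p s] t = (p t)%:R :> R.
Proof. by rewrite indicE mem_setE. Qed.

Lemma bmfD f g : bounded_measurable f -> bounded_measurable g ->
  bounded_measurable (fun t => f t + g t).
Proof.
move=> [mf [M fM]] [mg [N gN]]; split; first exact: measurable_funD.
by exists (M + N) => t; rewrite (le_trans (ler_normD _ _))// lerD.
Qed.

Lemma bmfM f g : bounded_measurable f -> bounded_measurable g ->
  bounded_measurable (fun t => f t * g t).
Proof.
move=> [mf [M fM]] [mg [N gN]]; split; first exact: measurable_funM.
by exists (M * N) => t; rewrite normrM ler_pM.
Qed.

Lemma bmfZ c f : bounded_measurable f -> bounded_measurable (fun t => c * f t).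
Proof. by apply: bmfM; exact: bmf_cst. Qed.

Lemma le_int f g : bounded_measurable f -> bounded_measurable g ->
  (forall t, f t <= g t) -> \int[P]_t f t <= \int[P]_t g t.
Proof. by move=> bf bg fg; apply: le_Rintegral => //; exact: bmfP. Qed.

Lemma intD f g : bounded_measurable f -> bounded_measurable g ->
  \int[P]_t (f t + g t) = \int[P]_t f t + \int[P]_t g t.
Proof. by move=> bf bg; apply: RintegralD => //; exact: bmfP. Qed.

Lemma intZ c f : bounded_measurable f ->
  \int[P]_t (c * f t) = c * \int[P]_t f t.
Proof. by move=> bf; apply: RintegralZl => //; exact: bmfP. Qed.

Lemma int_cst c : \int[P]_t c = c.
Proof. by rewrite Rintegral_cst//= probability_setT mulr1. Qed.

Lemma int_indic A : measurable A -> \int[P]_t \1_A t = pr A.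
Proof. by move=> mA; rewrite /Rintegral integral_indic// setIT. Qed.

Lemma int_EFin f : bounded_measurable f ->
  (\int[P]_t f t)%:E = (\int[P]_t (f t)%:E)%E.
Proof. by move=> /bmfP bf; rewrite /Rintegral fineK//; exact: integrable_fin_num. Qed.

Lemma measurable_gtr f x : measurable_fun setT f -> measurable [set t | x < f t].
Proof.
move=> mf; have := mf measurableT _ (measurable_itv `]x, +oo[).
by rewrite setTI; congr measurable; apply/seteqP; split => t /=; rewrite in_itv/= andbT.
Qed.

Lemma measurable_ler f x : measurable_fun setT f -> measurable [set t | f t <= x].
Proof.
move=> mf; have := mf measurableT _ (measurable_itv `]-oo, x]).
by rewrite setTI; congr measurable; apply/seteqP; split => t /=; rewrite in_itv.
Qed.

End probability_calculus.

Section law.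
Context {R : realType}.
Implicit Types F : df R.

#[local] Definition stieltjes F : probability (measurableTypeR R) R :=
  lebesgue_stieltjes_measure F.

#[local] Definition borel_id (x : measurableTypeR R) : R := x.

#[local] HB.instance Definition _ :=
  @isMeasurableFun.Build _ _ _ _ borel_id (@measurable_id _ _ setT).

(** The Stieltjes measure lives on a copy of the line with its own measurable
    structure; the image on the line itself can be compared with the distributions
    of random variables. *)
Definition law F : probability R R := distribution (stieltjes F) borel_id.

Lemma integral_law F (f : R -> \bar R) : measurable_fun setT f ->
  (forall y, 0 <= f y)%E ->
  (\int[law F]_y f y = \int[lebesgue_stieltjes_measure F]_y f y)%E.
Proof.
move=> mf f0.
exact: (@ge0_integral_distribution _ _ _ _ _ (stieltjes F) borel_id f mf f0).
Qed.

Lemma int_stieltjes F (f : R -> R) : measurable_fun setT f ->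
  (forall y, 0 <= f y) ->
  \int[lebesgue_stieltjes_measure F]_y f y = \int[law F]_y f y.
Proof.
move=> mf f0; rewrite /Rintegral integral_law//; exact/measurable_EFinP.
Qed.

Lemma law_le F x : pr (law F) [set y | y <= x] = F x.
Proof.
have := cdf_lebesgue_stieltjes_id F x; rewrite /cdf /distribution /pushforward.
rewrite preimage_id /pr -[law F _]/(lebesgue_stieltjes_measure F _).
rewrite [X in _ (_ X) = _ -> _](_ : _ = [set y | y <= x]) ?set_itvNyc//.
by move=> ->.
Qed.

Lemma law_gt F x : pr (law F) [set y | x < y] = tail F x.
Proof.
rewrite /tail -law_le -pr_setC; last exact: measurable_ler.
by congr pr; apply/seteqP; split => y /=; rewrite ltNge => /negP.
Qed.
End law.

(** * Product measures, tails and convolutions *)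

Section product_probability.
Context d1 d2 (T1 : measurableType d1) (T2 : measurableType d2) (R : realType).

Definition prod_prob (mu : probability T1 R) (nu : probability T2 R)
  : probability (T1 * T2)%type R := (mu \x nu)%E.

Lemma prod_prob_unique (mu : probability T1 R) (nu : probability T2 R)
    (rho : probability (T1 * T2)%type R) :
  (forall A B, measurable A -> measurable B ->
    pr rho (A `*` B) = pr mu A * pr nu B) ->
  forall C, measurable C -> pr rho C = pr (prod_prob mu nu) C.
Proof.
move=> rhoE C mC; rewrite {2}/pr; congr fine; apply/esym.
apply: (@product_measure_unique _ _ _ _ _ mu nu rho) => // A B mA mB.
by rewrite -[LHS]prE ?rhoE ?EFinM ?prE//; exact: measurableX.
Qed.

Lemma pr_prodX (mu : probability T1 R) (nu : probability T2 R) A B :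
  measurable A -> measurable B ->
  pr (prod_prob mu nu) (A `*` B) = pr mu A * pr nu B.
Proof.
move=> mA mB; rewrite /pr -fineM ?fin_num_measure//; congr fine.
exact: (product_measure1E mu nu).
Qed.

Lemma measurable_section (C : set (T1 * T2)) y :
  measurable C -> measurable [set z | C (y, z)].
Proof. by move=> mC; have := measurable_xsection y mC; rewrite xsectionE. Qed.

Lemma bmf_section (nu : probability T2 R) (C : set (T1 * T2)) :
  measurable C -> bounded_measurable (fun y => pr nu [set z | C (y, z)]).
Proof.
move=> mC; split; last first.
  exists 1 => y; rewrite ger0_norm ?pr_ge0// pr_le1//.
  exact: measurable_section.
apply/measurable_EFinP.
apply: eq_measurable_fun (measurable_fun_xsection nu mC) => y _ /=.
by rewrite xsectionE -prE//; exact: measurable_section.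
Qed.

Lemma pr_section (mu : probability T1 R) (nu : probability T2 R) (C : set (T1 * T2)) :
  measurable C ->
  pr (prod_prob mu nu) C = \int[mu]_y pr nu [set z | C (y, z)].
Proof.
move=> mC; apply: EFin_inj; rewrite prE// int_EFin; last exact: bmf_section.
apply: eq_integral => y _.
by rewrite /= xsectionE -prE//; exact: measurable_section.
Qed.

End product_probability.

Lemma pr_swap d1 d2 (T1 : measurableType d1) (T2 : measurableType d2)
    (R : realType) (mu : probability T1 R) (nu : probability T2 R) C :
  measurable C ->
  pr (prod_prob mu nu) [set p | C (p.2, p.1)] = pr (prod_prob nu mu) C.
Proof.
move=> mC.
have ms : measurable_fun setT (fun p : T1 * T2 => (p.2, p.1)).
  by apply: measurable_fun_pair; [exact: measurable_snd|exact: measurable_fst].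
pose sw : {mfun (T1 * T2)%type >-> (T2 * T1)%type} :=
  HB.pack (fun p : T1 * T2 => (p.2, p.1)) (isMeasurableFun.Build _ _ _ _ _ ms).
rewrite -[LHS]/(pr (distribution (prod_prob mu nu) sw) C).
apply: (@prod_prob_unique _ _ _ _ _ nu mu (distribution (prod_prob mu nu) sw) _ C mC).
move=> A B mA mB.
rewrite mulrC -pr_prodX//.
rewrite -[LHS]/(pr (prod_prob mu nu) (sw @^-1` (A `*` B))).
by congr pr; apply/seteqP; split => -[x y] /= [].
Qed.

Section tails.
Context {R : realType}.
Implicit Types F : df R.

Lemma tail_ni F : {homo tail F : x y / x <= y >-> y <= x}.
Proof.
by move=> x y xy; rewrite /tail lerD2l lerN2; exact: cumulative_is_nondecreasing.
Qed.

Lemma tail_ge0 F x : 0 <= tail F x.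
Proof. by rewrite -law_gt pr_ge0. Qed.

Lemma tail_le1 F x : tail F x <= 1.
Proof. by rewrite -law_gt pr_le1//; exact: measurable_gtr. Qed.

Lemma df_ge0 F x : 0 <= F x.
Proof. by rewrite -law_le pr_ge0. Qed.

Lemma df_tail F x : F x = 1 - tail F x.
Proof. by rewrite /tail opprB addrC subrK. Qed.

Lemma tail_gt0 F x : classF R F -> 0 < tail F x.
Proof. by move=> [_ /(_ x) F1]; rewrite /tail subr_gt0. Qed.

Lemma tail_lt0 F x : classF R F -> x < 0 -> tail F x = 1.
Proof. by move=> [F0 _] x0; rewrite /tail F0// subr0. Qed.

Lemma tail_cvg0 F : tail F x @[x --> +oo] --> 0.
Proof.
by rewrite -[X in _ --> X](subrr 1); apply: cvgB; [exact: cvg_cst|exact: cumulativey].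
Qed.

Lemma tail_small F e : 0 < e -> \forall x \near +oo, tail F x <= e.
Proof.
move=> e0; have /cvgrPdist_le/(_ e e0) := @tail_cvg0 F; apply: filterS => x.
by rewrite sub0r normrN ger0_norm// tail_ge0.
Qed.

Lemma law_lt0 F : classF R F -> pr (law F) [set y | y < 0] = 0.
Proof.
move=> [F0 _]; rewrite /pr (_ : [set y | y < 0] =
    \bigcup_n [set y : R | y <= - n.+1%:R^-1]).
  rewrite (@measure_negligible _ _ _ (law F))//.
    by apply: bigcupT_measurable => n; exact: measurable_ler.
  apply: negligible_bigcup => k.
  have mk : measurable [set y : R | y <= - k.+1%:R^-1] by exact: measurable_ler.
  apply/negligibleP => //; rewrite -[LHS]prE// law_le F0//.
apply/seteqP; split => [y /= y0|y [n _ /=] /le_lt_trans]; last first.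
  by apply; rewrite oppr_lt0 invr_gt0.
have [k yk] := ltr_add_invr y0.
by exists k => //=; move: yk; rewrite -ltrBrDr sub0r => /ltW.
Qed.

(** The negative half-line is a null set. Inequalities that only hold for
    nonnegative arguments, such as the subadditivity of truncations, become
    available at every point once the argument is replaced by its positive part. *)
Lemma int_pos_part F (f : R -> R) : classF R F -> bounded_measurable f ->
  \int[law F]_y f (Num.max (y : R) 0) = \int[law F]_y f y.
Proof.
move=> cF [mf [M fM]].
have mmax : measurable_fun setT (fun y : R => Num.max y 0).
  exact: measurable_maxr.
have bf : bounded_measurable f by split=> //; exists M.
have bf' : bounded_measurable (fun y : R => f (Num.max y 0)).
  by split; [exact: measurableT_comp mf mmax|exists M].
have mneg : measurable [set y : R | y < 0].
  by rewrite -set_itvNyo; exact: measurable_itv.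
have M0 : 0 <= M by exact: le_trans (fM 0).
have bi : bounded_measurable (fun y : R => 2 * M * \1_[set y : R | y < 0] y).
  by apply: bmfZ; exact: bmf_indic.
have i0 : \int[law F]_y (2 * M * \1_[set y : R | y < 0] y) = 0.
  by rewrite intZ ?int_indic ?law_lt0 ?mulr0//; exact: bmf_indic.
apply/eqP; rewrite eq_le; apply/andP; split.
- rewrite -[leRHS]addr0 -[X in _ <= _ + X]i0 -intD//; apply: le_int => //; first exact: bmfD.
  move=> y; rewrite indicE; have [y0|y0] := ltP y 0.
    rewrite mem_set//= mulr1.
    by have := fM 0; have := fM y; rewrite !ler_norml; lra.
  by rewrite memNset/= ?mulr0 ?addr0//; apply/negP; rewrite -leNgt.
- rewrite -[leRHS]addr0 -[X in _ <= _ + X]i0 -intD//; apply: le_int => //; first exact: bmfD.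
  move=> y; rewrite indicE; have [y0|y0] := ltP y 0.
    rewrite mem_set//= mulr1.
    by have := fM 0; have := fM y; rewrite !ler_norml; lra.
  by rewrite memNset/= ?mulr0 ?addr0//; apply/negP; rewrite -leNgt.
Qed.

End tails.

Section convolutions.
Context {R : realType}.
Implicit Types F : df R.

Lemma measurable_subl (x : R) : measurable_fun setT (fun y : R => x - y).
Proof. exact: measurable_funB. Qed.

(** Each convolution has to be known to be bounded and monotone, hence measurable,
    before the next one can be written as an integral. *)
Lemma nconv_props F n :
  (forall x, 0 <= nconv F n x <= 1) /\ {homo nconv F n : x y / x <= y}.
Proof.
elim: n => [|n [IH1 IH2]].
  split=> [x|x y xy] /=; first by case: (0 <= x); rewrite ?lexx ler01.
  case: (leP 0 x) => x0; last by case: (0 <= y).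
  by rewrite (le_trans x0 xy).
have mn : measurable_fun setT (nconv F n) by exact: nondecreasing_measurable.
have bn x : bounded_measurable (fun y : R => nconv F n (x - y)).
  split; first by apply: measurableT_comp mn _; exact: measurable_subl.
  by exists 1 => y; have /andP[? ?] := IH1 (x - y); rewrite ger0_norm.
have E x : nconv F n.+1 x = \int[law F]_y nconv F n (x - y).
  rewrite /= /convolution int_stieltjes//; first by case: (bn x).
  by move=> y; case/andP: (IH1 (x - y)).
split=> [x|x y xy].
  rewrite E; apply/andP; split.
    by rewrite Rintegral_ge0// => y _; case/andP: (IH1 (x - y)).
  rewrite -[leRHS](int_cst (law F) 1); apply: le_int => //; first exact: bmf_cst.
  by move=> y; case/andP: (IH1 (x - y)).
by rewrite !E; apply: le_int => // z; apply: IH2; rewrite lerD2r.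
Qed.

Lemma tail_nconv_ni F n : {homo tail (nconv F n) : x y / x <= y >-> y <= x}.
Proof.
by move=> x y xy; rewrite /tail lerD2l lerN2; exact: (nconv_props F n).2.
Qed.

Lemma tail_nconv_ge0 F n x : 0 <= tail (nconv F n) x.
Proof. by have [/(_ x)/andP[_ ?] _] := nconv_props F n; rewrite /tail subr_ge0. Qed.

Lemma tail_nconv_le1 F n x : tail (nconv F n) x <= 1.
Proof. by have [/(_ x)/andP[? _] _] := nconv_props F n; rewrite /tail gerBl. Qed.

Lemma bmf_tail_nconv F n x :
  bounded_measurable (fun y : R => tail (nconv F n) (x - y)).
Proof.
split; last by exists 1 => y; rewrite ger0_norm ?tail_nconv_ge0 ?tail_nconv_le1.
apply: measurableT_comp (measurable_subl x).
by apply: nonincreasing_measurable => //; exact: tail_nconv_ni.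
Qed.

Lemma tail_nconvS F n x :
  tail (nconv F n.+1) x = \int[law F]_y tail (nconv F n) (x - y).
Proof.
have [H1 H2] := nconv_props F n.
have mn : measurable_fun setT (nconv F n) by exact: nondecreasing_measurable.
have bn : bounded_measurable (fun y : R => nconv F n (x - y)).
  split; first by apply: measurableT_comp mn _; exact: measurable_subl.
  by exists 1 => y; have /andP[? ?] := H1 (x - y); rewrite ger0_norm.
rewrite {1}/tail /= /convolution int_stieltjes//; last 2 first.
- by case: bn.
- by move=> y; case/andP: (H1 (x - y)).
under [RHS]eq_Rintegral do rewrite /tail -mulN1r.
by rewrite intD ?intZ ?int_cst ?mulN1r//; [exact: bmf_cst|exact: bmfZ].
Qed.

Lemma nconv1 F x : nconv F 1 x = F x.
Proof.
rewrite /= /convolution int_stieltjes//; last first.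
  apply: nonincreasing_measurable => // u v uv.
  case: (leP 0 (x - v)) => // xv; by rewrite (le_trans xv)// lerD2l lerN2.
rewrite -(law_le F) -int_indic; last exact: measurable_ler.
by apply: eq_Rintegral => y _; rewrite indicE mem_setE subr_ge0.
Qed.

Lemma tail_nconv1 F : tail (nconv F 1) = tail F.
Proof. by apply/funext => x; rewrite /tail nconv1. Qed.

Definition pair_law F : probability (R * R)%type R := prod_prob (law F) (law F).

Lemma measurable_pair_add : measurable_fun setT (fun p : R * R => p.1 + p.2).
Proof. by apply: measurable_funD; [exact: measurable_fst|exact: measurable_snd]. Qed.

Lemma tail_nconv2 F x :
  tail (nconv F 2) x = pr (pair_law F) [set p | x < p.1 + p.2].
Proof.
rewrite tail_nconvS tail_nconv1 pr_section.
  apply: eq_Rintegral => y _; rewrite -law_gt; congr pr.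
  by apply/seteqP; split => z /=; rewrite ltrBlDl.
by apply: measurable_gtr; exact: measurable_pair_add.
Qed.
End convolutions.

(** * Sums of two variables without a big jump *)

Section no_jump.
Context {R : realType}.
Implicit Types F : df R.

Lemma near_translate (P : R -> Prop) a :
  (\forall x \near +oo, P x) -> \forall x \near +oo, P (x + a).
Proof.
case=> M [_ MP]; exists (M - a); split; first exact: num_real.
by move=> y yM; apply: MP; rewrite -ltrBlDr.
Qed.

Lemma near_ge (a : R) : \forall x \near +oo, a <= x.
Proof. by apply: nbhs_pinfty_ge; exact: num_real. Qed.

Definition no_jump_set (c x : R) : set (R * R) :=
  [set p | [/\ p.1 <= c, p.2 <= c & x < p.1 + p.2]].

Definition no_jump F (K x : R) : R := pr (pair_law F) (no_jump_set (x - K) x).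

(** The form of the class J used in all proofs. It involves two summands only and
    measures the exceptional event against the tail of [F] rather than against the
    tail of the sum; the two tails turn out to be comparable. *)
Definition single_jump F := forall e : R, 0 < e ->
  exists2 K : R, 0 <= K & \forall x \near +oo, no_jump F K x <= e * tail F x.

Lemma measurable_fst_gt (a : R) : measurable [set p : R * R | a < p.1].
Proof. by apply: measurable_gtr; exact: measurable_fst. Qed.

Lemma measurable_snd_gt (a : R) : measurable [set p : R * R | a < p.2].
Proof. by apply: measurable_gtr; exact: measurable_snd. Qed.

Lemma measurable_sum_gt (a : R) : measurable [set p : R * R | a < p.1 + p.2].
Proof. by apply: measurable_gtr; exact: measurable_pair_add. Qed.

Lemma measurable_no_jump_set c x : measurable (no_jump_set c x).
Proof.
rewrite (_ : no_jump_set c x = ~` [set p : R * R | c < p.1] `&`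
    ~` [set p : R * R | c < p.2] `&` [set p | x < p.1 + p.2]).
  apply: measurableI; last exact: measurable_sum_gt.
  apply: measurableI; apply: measurableC;
    [exact: measurable_fst_gt|exact: measurable_snd_gt].
apply/seteqP; split => p /=.
  by case=> *; split=> //; split; apply/negP; rewrite -leNgt.
by case=> [[/negP + /negP]]; rewrite -!leNgt => *; split.
Qed.

Lemma no_jump_ge0 F K x : 0 <= no_jump F K x.
Proof. exact: pr_ge0. Qed.

Lemma no_jump_ni F x : {homo no_jump F ^~ x : K L / K <= L >-> L <= K}.
Proof.
move=> K L KL; apply: pr_le; [exact: measurable_no_jump_set..|].
by move=> p [] p1 p2 ?; split=> //;
  [apply: le_trans p1 _|apply: le_trans p2 _]; rewrite lerD2l lerN2.
Qed.

Lemma law_oc F a b : a <= b ->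
  pr (law F) [set y | a < y <= b] = tail F a - tail F b.
Proof.
move=> ab; rewrite -(law_gt F a).
rewrite (@pr_setID _ _ _ _ [set y | b < y] [set y | a < y]); [|exact: measurable_gtr..].
rewrite (_ : [set y | a < y] `&` [set y | b < y] = [set y | b < y]).
  rewrite law_gt [RHS]addrC addrA addNr add0r; congr pr.
  apply/seteqP; split => y /=; first by case/andP => ? ?; split=> //; apply/negP; rewrite -leNgt.
  by case=> -> /negP; rewrite -leNgt => ->.
by apply/seteqP; split => y /=; [case|move=> yb; split=> //; exact: le_lt_trans yb].
Qed.

Lemma pair_fst_gt F a : pr (pair_law F) [set p | a < p.1] = tail F a.
Proof.
have mgt := measurable_gtr a (@measurable_id _ R setT).
rewrite -law_gt -[RHS]mulr1 -(prT (law F)) -(pr_prodX _ _ mgt measurableT).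
by congr pr; apply/seteqP; split => p /=; [|case].
Qed.

Lemma pair_snd_gt F a : pr (pair_law F) [set p | a < p.2] = tail F a.
Proof.
have mgt := measurable_gtr a (@measurable_id _ R setT).
rewrite -law_gt -[RHS]mul1r -(prT (law F)) -(pr_prodX _ _ measurableT mgt).
by congr pr; apply/seteqP; split => p /=; [|case].
Qed.

Lemma pair_both_gt F a : pr (pair_law F) [set p | a < p.1 /\ a < p.2] = tail F a ^+ 2.
Proof.
have mgt := measurable_gtr a (@measurable_id _ R setT).
by rewrite expr2 -law_gt -(pr_prodX (law F) (law F) mgt mgt).
Qed.

(** The rectangle [x - M < u <= x - K], [M < v <= x - K] consists of pairs with a
    large sum and no jump; this is what ties the tail at neighbouring points. *)
Lemma no_jump_rectangle F K M x : K <= M ->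
  (tail F (x - M) - tail F (x - K)) * (tail F M - tail F (x - K)) <= no_jump F K x.
Proof.
move=> KM; have t1 : tail F (x - K) <= tail F (x - M).
  by apply: tail_ni; rewrite lerD2l lerN2.
have [Mx|Mx] := leP M (x - K); last first.
  apply: le_trans (no_jump_ge0 F K x); rewrite mulr_ge0_le0 ?subr_ge0//.
  by rewrite subr_le0 tail_ni// ltW.
rewrite -law_oc ?lerD2l ?lerN2// -law_oc//.
have moc a b : measurable [set y : R | a < y <= b].
  by rewrite -set_itvoc; exact: measurable_itv.
rewrite -pr_prodX//; apply: pr_le.
- exact: measurableX.
- exact: measurable_no_jump_set.
- move=> p [/= /andP[p1 p2] /andP[p3 p4]]; split=> //.
  by rewrite -(subrK M x) ltrD.
Qed.

Lemma tail_nconv2_le F K x :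
  tail (nconv F 2) x <= no_jump F K x + 2 * tail F (x - K).
Proof.
rewrite tail_nconv2 mulr_natl mulr2n -{1}pair_fst_gt -pair_snd_gt.
have m1 := measurable_fst_gt (x - K); have m2 := measurable_snd_gt (x - K).
apply: (@le_trans _ _ (no_jump F K x +
    pr (pair_law F) ([set p | x - K < p.1] `|` [set p | x - K < p.2]))).
  apply: pr_leD.
  - exact: measurable_sum_gt.
  - exact: measurable_no_jump_set.
  - exact: measurableU.
  move=> p /= px; have [p1|p1] := ltP (x - K) p.1; first by right; left.
  have [p2|p2] := ltP (x - K) p.2; first by right; right.
  by left.
by rewrite lerD2l prU2// gerBl pr_ge0.
Qed.

(** Apart from the sums without a jump, the sum exceeds [x] whenever one of the
    two summands does. *)
Lemma tail_nconv2_ge F K x : classF R F -> 0 <= K -> 0 <= x ->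
  no_jump F K x + 2 * tail F x - tail F x ^+ 2 <= tail (nconv F 2) x.
Proof.
move=> cF K0 x0.
have mg0 : measurable [set y : R | y < 0] by rewrite -set_itvNyo; exact: measurable_itv.
have mge0 := measurableC mg0.
have mgt := measurable_gtr x (@measurable_id _ R setT).
have p0 : pr (law F) (~` [set y | y < 0]) = 1.
  by rewrite pr_setC// law_lt0// subr0.
pose A : set (R * R) := [set y | x < y] `*` ~` [set y | y < 0].
pose B : set (R * R) := ~` [set y | y < 0] `*` [set y | x < y].
have mA : measurable A by exact: measurableX.
have mB : measurable B by exact: measurableX.
have pA : pr (pair_law F) A = tail F x by rewrite pr_prodX// p0 mulr1 law_gt.
have pB : pr (pair_law F) B = tail F x by rewrite pr_prodX// p0 mul1r law_gt.
have pAB : pr (pair_law F) (A `&` B) <= tail F x ^+ 2.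
  rewrite -pair_both_gt; apply: pr_le; first exact: measurableI.
    by apply: measurableI; [exact: measurable_fst_gt|exact: measurable_snd_gt].
  by move=> p [[/= p1 _] [_ /= p2]].
have mN := measurable_no_jump_set (x - K) x.
have mU : measurable (A `|` B) by exact: measurableU.
have xK : x - K <= x by rewrite gerBl.
suff : no_jump F K x + pr (pair_law F) (A `|` B) <= tail (nconv F 2) x.
  rewrite (prU2 _ mA mB) pA pB; move: pAB.
  move: (pr _ (A `&` B)) (tail F x) (no_jump F K x) (tail (nconv F 2) x) => *; lra.
rewrite tail_nconv2 /no_jump -prU//.
  apply: pr_le; [exact: measurableU|exact: measurable_sum_gt|].
  move=> p [[]//|[[/= p1 /negP]|[/= /negP + p2]]]; rewrite -leNgt => ?.
    by rewrite -[x]addr0 ltr_leD.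
  by rewrite -[x]add0r ler_ltD.
apply/seteqP; split => // p [[p1 p2 _]] [[/= + _]|[_ /= +]].
  by move=> /lt_le_trans/(_ p1)/lt_le_trans/(_ xK); rewrite ltxx.
by move=> /lt_le_trans/(_ p2)/lt_le_trans/(_ xK); rewrite ltxx.
Qed.

(** Where the rectangle estimate has a second side of fixed mass, it bounds the
    increase of the tail over a unit step, hence over every step. *)
Lemma no_jump_tail_shift F K A : classF R F -> 0 < A ->
  (\forall x \near +oo, no_jump F K x <= A * tail F (x - K)) ->
  forall L, exists2 C, 0 < C & \forall x \near +oo, tail F (x - L) <= C * tail F x.
Proof.
move=> cF A0 HK L; set M := K + 1.
have KM : K <= M by rewrite lerDl.
have tM : 0 < tail F M by exact: tail_gt0.
set C := 1 + 2 * A / tail F M.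
have C1 : 0 < C by rewrite addr_gt0// divr_gt0// mulr_gt0.
have HC : \forall x \near +oo, tail F (x - 1) <= C * tail F x.
  suff : \forall x \near +oo, tail F (x - M) <= C * tail F (x - K).
    move=> /(near_translate K); apply: filterS => x.
    by rewrite addrK /M opprD addrA addrK.
  have tM2 : 0 < tail F M / 2 by rewrite divr_gt0.
  have /(near_translate (- K)) := tail_small F tM2; apply: filterS2 HK => x Hx sx.
  have := no_jump_rectangle F x KM => /le_trans/(_ Hx) H.
  have t1 : tail F (x - K) <= tail F (x - M) by rewrite tail_ni// lerD2l lerN2.
  rewrite -(ler_pM2r tM2).
  have -> : C * tail F (x - K) * (tail F M / 2) =
      tail F (x - K) * (tail F M / 2) + A * tail F (x - K).
    by rewrite /C; field; rewrite gt_eqF.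
  nra.
have H n : \forall x \near +oo, tail F (x - n%:R) <= C ^+ n * tail F x.
  elim: n => [|n IH]; first by near=> x; rewrite subr0 expr0 mul1r.
  have := near_translate (- n%:R) HC; apply: filterS2 IH => x H1 H2.
  rewrite -addn1 natrD opprD addrA (le_trans H2)// addn1 exprS -mulrA.
  by rewrite ler_wpM2l// ltW.
exists (C ^+ (Num.truncn L).+1); first by rewrite exprn_gt0.
apply: filterS (H (Num.truncn L).+1) => x; apply: le_trans.
by rewrite tail_ni// lerD2l lerN2 ltW// truncnS_gt.
Unshelve. all: by end_near. Qed.

Section consequences.
Variable F : df R.
Hypotheses (cF : classF R F) (sjF : single_jump F).

Lemma tail_shift_le L : exists2 C, 0 < C &
  \forall x \near +oo, tail F (x - L) <= C * tail F x.
Proof.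
have [K K0 HK] := sjF ltr01; apply: (no_jump_tail_shift cF ltr01 (K := K)).
by apply: filterS HK => x /le_trans; apply; rewrite !mul1r tail_ni// gerBl.
Qed.

Lemma tail_nconv2_bound : exists2 C, 0 < C &
  \forall x \near +oo, tail (nconv F 2) x <= C * tail F x.
Proof.
have [K K0 HK] := sjF ltr01; have [C C0 HC] := tail_shift_le K.
exists (1 + 2 * C); first by rewrite addr_gt0// mulr_gt0.
apply: filterS2 HK HC => x HK HC; have := tail_nconv2_le F K x; lra.
Qed.

(** In the rectangle estimate the corner terms [tail F M * tail F (x - K)] and
    [tail F (x - M) * tail F (x - K)] are small with respect to [tail F x], since
    [tail F (x - K) / tail F x] stays bounded. The second bound pays for the
    boundary term that appears when a sum is compared with a single variable. *)
Lemma single_jump_ends e : 0 < e -> exists2 M, 0 <= M &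
  \forall x \near +oo, no_jump F M x <= e * tail F x /\
                       tail F M * tail F (x - M) <= e * tail F x.
Proof.
move=> e0; have e3 : 0 < e / 3 by rewrite divr_gt0.
have [K K0 HK] := sjF e3; have [C C0 HC] := tail_shift_le K.
have [M KM tM] : exists2 M, K <= M & tail F M <= e / 3 / C.
  apply: (@pinfty_ex_ge _ K (fun M => tail F M <= e / 3 / C)).
    exact: num_real.
  by apply: tail_small; rewrite divr_gt0.
exists M; first exact: le_trans KM.
have eC : 0 < e / 3 / C by rewrite divr_gt0.
have /(near_translate (- M)) := tail_small F eC.
apply: filterS3 HK HC => x HK HC Hs; split.
  apply: le_trans (no_jump_ni F x KM) (le_trans HK _).
  by rewrite ler_wpM2r ?tail_ge0//; lra.
have := no_jump_rectangle F x KM => /le_trans/(_ HK) H.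
have H1 : tail F M * tail F (x - K) <= e / 3 * tail F x.
  apply: (@le_trans _ _ (e / 3 / C * (C * tail F x))).
    by rewrite ler_pM ?tail_ge0.
  by rewrite mulrA divfK// gt_eqF.
have H2 : tail F (x - M) * tail F (x - K) <= e / 3 * tail F x.
  apply: (@le_trans _ _ (e / 3 / C * (C * tail F x))).
    by rewrite ler_pM ?tail_ge0.
  by rewrite mulrA divfK// gt_eqF.
have := sqr_ge0 (tail F (x - K)); rewrite expr2; nra.
Qed.
End consequences.
End no_jump.

(** * Limits inferior and partial sums of independent variables *)

Section liminf.
Context {R : realType}.
Implicit Types (f : R -> R) (r : R -> R -> R).

Lemma limf_einf_ge f (a : R) : (\forall x \near +oo, a <= f x) ->
  (a%:E <= limf_einf (fun x => (f x)%:E) +oo%R)%E.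
Proof.
move=> af; rewrite limf_einfE; apply: le_trans; last first.
  by apply: ereal_sup_ubound; exists [set x | a <= f x].
by apply: le_ereal_inf_tmp => _ [x ax <-]; rewrite lee_fin.
Qed.

Lemma limf_einf_le f (a : R) : (forall x, f x <= a) ->
  (limf_einf (fun x => (f x)%:E) +oo%R <= a%:E)%E.
Proof.
move=> fa; rewrite limf_einfE; apply: ge_ereal_sup => _ [V VF <-].
have [x Vx] := @filter_ex _ _ proper_pinfty_nbhs V VF.
by apply: ge_ereal_inf; exists (f x)%:E; [exists x|rewrite lee_fin].
Qed.

Lemma limf_einf_gt f (a : R) :
  (a%:E < limf_einf (fun x => (f x)%:E) +oo%R)%E -> \forall x \near +oo, a <= f x.
Proof.
rewrite limf_einfE => /ereal_sup_gt[_ [V VF <-]] aV.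
apply: filterS VF => x Vx; rewrite -lee_fin; apply/ltW/(lt_le_trans aV).
by apply: ereal_inf_lbound; exists x.
Qed.

Lemma limf_esup_lty f : (limf_esup (fun x => (f x)%:E) +oo%R < +oo)%E ->
  exists2 C, 0 < C & \forall x \near +oo, f x <= C.
Proof.
rewrite limf_esupE => /ereal_inf_lt[_ [V VF <-]] Voo.
have [x0 Vx0] := @filter_ex _ _ proper_pinfty_nbhs V VF.
have H x : V x -> ((f x)%:E <= ereal_sup ((fun x => (f x)%:E) @` V))%E.
  by move=> Vx; apply: ereal_sup_ubound; exists x.
move: Voo H; case: (ereal_sup _) => [s| |]// _ H; last by have := H _ Vx0.
exists (Num.max 1 s); first by rewrite lt_max ltr01.
by apply: filterS VF => x /H; rewrite lee_fin le_max => ->; rewrite orbT.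
Qed.

Lemma limf_esup_le f (C : R) : (\forall x \near +oo, f x <= C) ->
  (limf_esup (fun x => (f x)%:E) +oo%R < +oo)%E.
Proof.
move=> fC; rewrite limf_esupE; apply: le_lt_trans (ltry C).
apply: (@le_trans _ _ (ereal_sup ((fun x => (f x)%:E) @` [set x | f x <= C]))).
  by apply: ereal_inf_lbound; exists [set x | f x <= C].
by apply: ge_ereal_sup => _ [x fx <-]; rewrite lee_fin.
Qed.

Lemma limf_einf_cvg1 r : (forall K x, r K x <= 1) ->
  (forall e, 0 < e -> exists K0, forall K, K0 <= K ->
    \forall x \near +oo, 1 - e <= r K x) ->
  limf_einf (fun x => (r K x)%:E) +oo%R @[K --> +oo%R] --> 1%E.
Proof.
move=> r1 H; pose L K := limf_einf (fun x => (r K x)%:E) +oo%R.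
have L1 K : (L K <= 1%:E)%E by exact: limf_einf_le.
have Le e : 0 < e -> \forall K \near +oo%R, ((1 - e)%:E <= L K)%E.
  move=> /H[K0 HK0]; apply: filterS (near_ge K0) => K /HK0; exact: limf_einf_ge.
apply/fine_cvgP; split.
  apply: filterS (Le 1 ltr01) => K /(lt_le_trans (ltNyr _)) LK.
  by rewrite fin_real// LK (le_lt_trans (L1 K))// ltry.
apply/cvgrPdist_le => e e0; apply: filterS (Le _ e0) => K /=.
rewrite -/(L K); have := L1 K; case: (L K) => [l| |]//=.
rewrite !lee_fin => l1 le1; rewrite ger0_norm ?subr_ge0//; lra.
Qed.

Lemma cvg1_limf_einf r :
  limf_einf (fun x => (r K x)%:E) +oo%R @[K --> +oo%R] --> 1%E ->
  forall e, 0 < e -> exists2 K, 0 <= K & \forall x \near +oo, 1 - e <= r K x.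
Proof.
move=> r1 e e0.
have : \forall K \near +oo%R,
    ((1 - e)%:E < limf_einf (fun x => (r K x)%:E) +oo%R)%E.
  have lt1 : ((1 - e)%:E < 1%:E)%E by rewrite lte_fin gtrBl.
  exact: (r1 _ (open_ereal_gt' lt1)).
case/(pinfty_ex_ge (num_real (0 : R))) => K K0 /limf_einf_gt rK.
by exists K.
Qed.
End liminf.

Section iid_sums.
Context d (T : measurableType d) (R : realType) (P : probability T R).
Variables (n : nat) (X : 'I_n -> {RV P >-> R}) (F : df R).
Hypotheses (cF : classF R F) (XF : iid X F).

Lemma law_unique (rho : probability R R) :
  (forall x, pr rho [set y | x < y] = tail F x) ->
  forall A, measurable A -> pr rho A = pr (law F) A.
Proof.
move=> rF A mA; rewrite /pr; congr fine.
apply: (measure_unique (@RGenOInfty.G R) (fun k => `]- k%:R, +oo[%classic)) => //.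
- exact: RGenOInfty.measurableE.
- move=> _ _ [x ->] [y ->]; exists (Num.max x y).
  by apply/seteqP; split => z /=; rewrite !in_itv/= !andbT gt_max => /andP.
- by move=> k; exists (- k%:R).
- apply/seteqP; split => // z _; exists (Num.truncn `|z|).+1 => //=.
  rewrite in_itv/= andbT ltrNl (le_lt_trans _ (truncnS_gt `|z|))//.
  by rewrite -normrN ler_norm.
- move=> _ [x ->]; have mx : measurable `]x, +oo[%classic by exact: measurable_itv.
  rewrite -[LHS]prE// -[RHS]prE//; congr EFin.
  by rewrite set_itvoy rF law_gt.
- by move=> k; apply: le_lt_trans (ltry 1); exact: probability_le1.
Qed.

Lemma mX i : measurable_fun setT (X i : T -> R).
Proof. exact: measurable_funPT. Qed.

Lemma mX_preimage i B : measurable B -> measurable (X i @^-1` B).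
Proof. by move=> mB; rewrite -[_ @^-1` _]setTI; exact: mX. Qed.

Lemma iid_law i B : measurable B -> pr P (X i @^-1` B) = pr (law F) B.
Proof.
move=> mB; apply: (law_unique (rho := distribution P (X i))) => // x.
rewrite /tail; have -> : F x = pr (distribution P (X i)) [set y | y <= x].
  apply: EFin_inj; rewrite -(XF.1 i x) prE ?set_itvNyc//.
  by rewrite -set_itvNyc; exact: measurable_itv.
rewrite -pr_setC; last exact: measurable_ler.
by congr pr; apply/seteqP; split => y /=; rewrite ltNge => /negP.
Qed.

Lemma iid_prod (J : {set 'I_n}) (B : 'I_n -> set R) :
  (forall i, measurable (B i)) ->
  pr P (\bigcap_(i in [set` J]) X i @^-1` B i) = \prod_(i in J) pr (law F) (B i).
Proof.
move=> mB; rewrite /pr XF.2//; apply: eq_bigr => i _.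
by rewrite -/(pr P _) iid_law.
Qed.

Lemma rv_sum_ge_tail (i0 : 'I_n) x : 0 <= x ->
  tail F x <= pr P [set t | x < rv_sum X t].
Proof.
move=> x0; have mneg : measurable [set y : R | y < 0].
  by rewrite -set_itvNyo; exact: measurable_itv.
have mgt : measurable [set y : R | x < y] by exact: measurable_gtr.
pose B i : set R := if i == i0 then [set y | x < y] else ~` [set y | y < 0].
have mB i : measurable (B i).
  by rewrite /B; case: ifP => // _; exact: measurableC.
have -> : tail F x = \prod_(i in [set: 'I_n]%SET) pr (law F) (B i).
  rewrite (bigD1 i0) ?inE//= {1}/B eqxx law_gt big1 ?mulr1// => i /andP[_ /negbTE ii0].
  by rewrite /B ii0 pr_setC// law_lt0// subr0.
rewrite -iid_prod//; apply: pr_le.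
- apply: fin_bigcap_measurable => // i _; exact: mX_preimage.
- by apply: measurable_gtr; apply: measurable_sum => i; exact: mX.
move=> t Bt /=; rewrite /rv_sum (bigD1 i0)//=.
have := Bt i0; rewrite /B /= eqxx => /(_ (finset.in_setT _)) xi0.
rewrite -[x]addr0 ltr_leD// sumr_ge0// => i /negbTE ii0.
have := Bt i; rewrite /B /= ii0 => /(_ (finset.in_setT _)) /negP.
by rewrite -leNgt.
Qed.

Definition partial_sum j t := \sum_(i < n) (if (i < j)%N then X i t else 0).

Lemma partial_sumS (j : 'I_n) t :
  partial_sum j.+1 t = X j t + partial_sum j t.
Proof.
rewrite /partial_sum (bigD1 j)//= ltnSn; congr (_ + _).
rewrite [RHS](bigD1 j)//= ltnn add0r; apply: eq_bigr => i ij.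
by rewrite ltnS leq_eqVlt val_eqE (negbTE ij).
Qed.

Lemma partial_sum0 t : partial_sum 0 t = 0.
Proof. by rewrite /partial_sum big1. Qed.

Lemma partial_sumn t : partial_sum n t = rv_sum X t.
Proof. by apply: eq_bigr => i _; rewrite ltn_ord. Qed.

Lemma measurable_partial_sum j : measurable_fun setT (partial_sum j).
Proof.
by apply: measurable_sum => i; case: (i < j)%N; [exact: mX|exact: measurable_cst].
Qed.

(** The events that only depend on the first [j] variables form a sigma-algebra
    generated by rectangles, on which both sides are finite measures. *)
Lemma partial_sum_indep (j : 'I_n) A B : measurable A -> measurable B ->
  pr P ((X j @^-1` B) `&` (partial_sum j @^-1` A)) =
  pr (law F) B * pr P (partial_sum j @^-1` A).
Proof.
move=> mA mB.
pose before := [set i : 'I_n | (i < j)%N]%SET.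
pose rect (C : 'I_n -> set R) := \bigcap_(i in [set` before]) X i @^-1` C i.
pose G : set (set T) := [set rect C | C in [set C | forall i, measurable (C i)]].
have mrect C : (forall i, measurable (C i)) -> measurable (rect C).
  move=> mC; apply: fin_bigcap_measurable => // i _; exact: mX_preimage.
have mG : G `<=` measurable by move=> _ [C mC <-]; exact: mrect.
have mXB : measurable (X j @^-1` B) by exact: mX_preimage.
have pB0 : 0 <= pr P (X j @^-1` B) := pr_ge0 _ _.
pose c : {nonneg R} := NngNum pB0.
have sub : <<s G >> `<=` measurable.
  by apply: smallest_sub => //; exact: sigma_algebra_measurable.
have GA : <<s G >> (partial_sum j @^-1` A).
  have mf : measurable_fun setT (partial_sum j : g_sigma_algebraType G -> R).
    apply: measurable_sum => i; case: (boolP (i < j)%N) => ij; last exact: measurable_cst.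
    move=> _ C mC; rewrite setTI; apply: sub_sigma_algebra.
    exists (fun k => if k == i then C else setT).
      by move=> k; case: ifP.
    apply/seteqP; split => t /=.
      by move=> /(_ i); rewrite /= inE eqxx; apply.
    by move=> Ct k _ /=; case: eqP => // ->.
  by have := mf measurableT A mA; rewrite setTI.
suff : mrestr P mXB (partial_sum j @^-1` A) = mscale c P (partial_sum j @^-1` A).
  have mS := sub _ GA.
  rewrite -[LHS]/(P (partial_sum j @^-1` A `&` X j @^-1` B)).
  rewrite -[RHS]/((pr P (X j @^-1` B))%:E * P (partial_sum j @^-1` A))%E setIC -(prE P (measurableI _ _ mXB mS)) -(prE P mS).
  by rewrite -EFinM iid_law// => -[].
apply: (g_sigma_algebra_measure_unique G mG (fun=> setT)) => //.
- move=> _; exists (fun=> setT) => //.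
  by apply/seteqP; split => t // _ i _.
- by apply/seteqP; split => t // _; exists 0%N.
- move=> _ _ [C mC <-] [D mD <-]; exists (fun i => C i `&` D i).
    by move=> i; exact: measurableI.
  apply/seteqP; split => t /=.
    by move=> CD; split => i /CD [].
  by case=> Ct Dt i ij; split; [exact: Ct|exact: Dt].
- move=> _ [C mC <-].
  rewrite -[LHS]/(P (rect C `&` X j @^-1` B)) -[RHS]/((pr P (X j @^-1` B))%:E * P (rect C))%E.
  have mr := mrect C mC.
  rewrite -(prE P (measurableI _ _ mr mXB)) -(prE P mr) -EFinM; congr EFin.
  pose C' i := if i == j then B else C i.
  have mC' i : measurable (C' i) by rewrite /C'; case: ifP.
  have -> : rect C `&` X j @^-1` B =
      \bigcap_(i in [set` (j |: before)%SET]) X i @^-1` C' i.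
    apply/seteqP; split => t /=.
      move=> [Ct Bt] i /=; rewrite !inE /C' => /orP[/eqP -> |ij]; first by rewrite eqxx.
      by case: eqP ij => [->//|_ ij]; apply: Ct; rewrite /= inE.
    move=> H; split; last by have := H j; rewrite /= /C' eqxx !inE eqxx; exact.
    move=> i /=; rewrite inE => ij; have := H i; rewrite /= /C' !inE ij orbT => /(_ isT).
    by case: eqP ij => // ->; rewrite /= ltnn.
  rewrite iid_prod// big_setU1 ?inE ?ltnn//= /C' eqxx iid_law//; congr (_ * _).
  rewrite /rect iid_prod//; apply: eq_bigr => i; rewrite inE.
  by case: eqP => // ->; rewrite ltnn.
- move=> k; rewrite -[ltLHS]/(P (setT `&` X j @^-1` B)) setTI.
  by apply: le_lt_trans (ltry 1); exact: probability_le1.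
Qed.
End iid_sums.

(** * From two summands to any number of summands *)

Section comparison.
Context {R : realType}.
Variables (F : df R) (nu : probability R R) (C : R).
Hypotheses (C0 : 0 <= C) (nuC : forall z, pr nu [set s | z < s] <= C * tail F z).

(** The section of the event at a given last summand is a half-line, where
    domination of tails applies directly. *)
Lemma compare_sum x :
  pr (prod_prob (law F) nu) [set p | x < p.1 + p.2] <= C * tail (nconv F 2) x.
Proof.
have m := measurable_sum_gt x.
rewrite tail_nconv2 !pr_section// -intZ; last exact: bmf_section.
apply: le_int => [||y].
- exact: bmf_section.
- by apply: bmfZ; exact: bmf_section.
- have E : [set z | [set p | x < p.1 + p.2] (y, z)] = [set z | x - y < z].
    by apply/seteqP; split => z /=; rewrite ltrBlDl.
  by rewrite E law_gt; exact: nuC.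
Qed.

(** Domination of tails does not give domination on the bounded section
    [x - y < s <= c], only up to the mass beyond [c]. *)
Lemma compare_no_jump x c :
  pr (prod_prob (law F) nu) (no_jump_set c x) <=
  C * (pr (pair_law F) (no_jump_set c x) + tail F c * tail F (x - c)).
Proof.
have m := measurable_no_jump_set c x.
have mc := @measurable_gtr _ _ R id (x - c) (@measurable_id _ R setT).
have b1 := bmf_section nu m; have b2 := bmf_section (law F) m.
have b3 := bmf_indic R mc.
rewrite !pr_section// -(law_gt F (x - c)) -int_indic// -intZ//.
rewrite -intD//; last exact: bmfZ.
rewrite -intZ; last by apply: bmfD => //; exact: bmfZ.
apply: le_int => [||y].
- exact: bmf_section.
- by apply: bmfZ; apply: bmfD => //; exact: bmfZ.
have msec := measurable_section y m.
have pos : 0 <= C * (pr (law F) [set z | no_jump_set c x (y, z)] +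
    tail F c * \1_[set y | x - c < y] y).
  by rewrite mulr_ge0// addr_ge0 ?pr_ge0// mulr_ge0 ?tail_ge0// indicE.
have [yc|yc] := leP y c; last first.
  apply: le_trans pos; rewrite [X in pr nu X](_ : _ = set0) ?pr0//.
  by apply/seteqP; split => // z [/= /(lt_le_trans yc)]; rewrite ltxx.
have [yxc|yxc] := leP y (x - c).
  apply: le_trans pos; rewrite [X in pr nu X](_ : _ = set0) ?pr0//.
  apply/seteqP; split => // z [/= _ zc]; apply/negP; rewrite -leNgt.
  by rewrite -(subrK c x) lerD.
rewrite indicE mem_set//= mulr1.
have xyc : x - y <= c by rewrite lerBlDr -lerBlDl ltW.
apply: (@le_trans _ _ (C * tail F (x - y))).
  apply: le_trans (nuC (x - y)); apply: pr_le => //.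
    by apply: measurable_gtr; exact: measurable_id.
  by move=> z [/= _ _]; rewrite ltrBlDl.
apply: ler_wpM2l => //.
rewrite -(subrK (tail F c) (tail F (x - y))) lerD2r -law_oc//.
apply: pr_le => //; first by rewrite -set_itvoc; exact: measurable_itv.
by move=> z /= /andP[xyz zc]; split => //=; rewrite -ltrBlDl.
Qed.
End comparison.

Section single_jump_iid.
Context d (T : measurableType d) (R : realType) (P : probability T R).
Variables (n : nat) (X : 'I_n -> {RV P >-> R}) (F : df R).
Hypotheses (cF : classF R F) (XF : iid X F) (sjF : single_jump F).

Let mS j := measurable_partial_sum X j.

Lemma measurable_pair_partial_sum (j : 'I_n) :
  measurable_fun setT (fun t => (X j t, partial_sum X j t)).
Proof. by apply: measurable_fun_pair; [exact: mX|exact: mS]. Qed.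

Definition partial_sum_law j : probability R R :=
  distribution P (HB.pack_for {mfun T >-> R} (partial_sum X j)
    (isMeasurableFun.Build _ _ _ _ _ (mS j))).

(** Rectangles determine the joint law, so the last summand and the sum of the
    previous ones can be replaced by the coordinates of a product space. *)
Lemma joint_law (j : 'I_n) C : measurable C ->
  pr P [set t | C (X j t, partial_sum X j t)] =
  pr (prod_prob (law F) (partial_sum_law j)) C.
Proof.
move=> mC.
pose rho : probability (R * R)%type R := distribution P
  (HB.pack_for {mfun T >-> (R * R)%type} (fun t => (X j t, partial_sum X j t))
    (isMeasurableFun.Build _ _ _ _ _ (measurable_pair_partial_sum j))).
apply: (@prod_prob_unique _ _ _ _ _ (law F) (partial_sum_law j) rho _ C mC).
by move=> A B mA mB; exact: (partial_sum_indep XF j mB mA).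
Qed.

Lemma tail_nconv2_le_tail : exists2 C, 0 < C &
  forall z, tail (nconv F 2) z <= C * tail F z.
Proof.
have [C C0 [M [_ HC]]] := tail_nconv2_bound cF sjF.
have tM : 0 < tail F (M + 1) by exact: tail_gt0.
exists (Num.max C (tail F (M + 1))^-1); first by rewrite lt_max C0.
move=> z; have [zM|zM] := ltP M z.
  by apply: le_trans (HC z zM) _; rewrite ler_wpM2r ?tail_ge0// le_max lexx.
apply: le_trans (tail_nconv_le1 _ _ _) _.
apply: (@le_trans _ _ ((tail F (M + 1))^-1 * tail F z)).
  by rewrite -ler_pdivrMl ?invr_gt0// invrK mulr1 tail_ni// (le_trans zM)// lerDl.
by rewrite ler_wpM2r ?tail_ge0// le_max lexx orbT.
Qed.

Lemma partial_sum_le_tail j : (j <= n)%N -> exists2 C, 0 < C &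
  forall z, pr P [set t | z < partial_sum X j t] <= C * tail F z.
Proof.
elim: j => [_|j IH jn].
  exists 1 => // z; rewrite mul1r; have [z0|z0] := ltP z 0.
    by rewrite tail_lt0// pr_le1//; apply: measurable_gtr; exact: mS.
  rewrite (_ : [set t | _] = set0) ?pr0 ?tail_ge0//.
  by apply/seteqP; split => // t /=; rewrite partial_sum0 ltNge z0.
have [C C0 HC] := IH (ltnW jn); have [D D0 HD] := tail_nconv2_le_tail.
exists (C * D); first by rewrite mulr_gt0.
move=> z; pose i := Ordinal jn.
have -> : [set t | z < partial_sum X j.+1 t] =
    [set t | [set p | z < p.1 + p.2] (X i t, partial_sum X i t)].
  by apply/seteqP; split => t /=; rewrite (partial_sumS X i).
rewrite (@joint_law i [set p | z < p.1 + p.2]); last exact: measurable_sum_gt.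
apply: le_trans (compare_sum _ _) _; first exact: HC.
by rewrite -mulrA ler_wpM2l// ltW.
Qed.

Definition all_le j c := \bigcap_(i in [set i : 'I_n | (i < j)%N]) [set t | X i t <= c].

Lemma measurable_all_le j c : measurable (all_le j c).
Proof.
by apply: fin_bigcap_measurable => // i _; apply: measurable_ler; exact: mX.
Qed.

(** Induction on the number of summands: either the sum of the first [j] ones stays
    below [x - M], and then it competes with the next one like a single variable, or
    it exceeds [x - M] without a jump. *)
Lemma partial_sum_no_jump j : (j <= n)%N -> forall e, 0 < e ->
  exists2 K, 0 <= K & \forall x \near +oo,
    pr P (all_le j (x - K) `&` [set t | x < partial_sum X j t]) <= e * tail F x.
Proof.
elim: j => [_ e e0|j IH jn e e0].
  exists 0 => //; apply: filterS (near_ge 0) => x x0.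
  rewrite (_ : _ `&` _ = set0) ?pr0 ?mulr_ge0 ?tail_ge0 ?(ltW e0)//.
  by apply/seteqP; split => // t [_] /=; rewrite partial_sum0 ltNge x0.
have [C C0 HC] := partial_sum_le_tail (ltnW jn).
have eC : 0 < e / (4 * C) by rewrite divr_gt0// mulr_gt0.
have [M M0 HM] := single_jump_ends cF sjF eC.
have [D D0 HD] := tail_shift_le cF sjF M.
have eD : 0 < e / (2 * D) by rewrite divr_gt0// mulr_gt0.
have [K K0 HK] := IH (ltnW jn) _ eD.
exists (K + M); first by rewrite addr_ge0.
have /= := near_translate (- M) HK.
apply: filterS3 HM HD => x [H1 H2] H3 H4.
pose i := Ordinal jn.
have xKM : x - (K + M) = x - M - K by ring.
have m1 := measurable_all_le j.+1 (x - (K + M)).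
have m2 := measurable_all_le j (x - M - K).
have mgt k y : measurable [set t | y < partial_sum X k t].
  by apply: measurable_gtr; exact: mS.
have mN : measurable [set t | no_jump_set (x - M) x (X i t, partial_sum X i t)].
  have := measurable_pair_partial_sum i measurableT (measurable_no_jump_set (x - M) x).
  by rewrite setTI.
apply: (@le_trans _ _ (pr P [set t | no_jump_set (x - M) x (X i t, partial_sum X i t)]
   + pr P (all_le j (x - M - K) `&` [set t | x - M < partial_sum X j t]))).
  apply: pr_leD => //; [exact: measurableI|exact: measurableI|].
  move=> t [At /= St].
  have [Sj|Sj] := ltP (x - M) (partial_sum X j t); [right|left].
    by split => // k /= kj; rewrite -xKM; apply: At => /=; exact: ltnW.
  split=> //=; last by move: St; rewrite (partial_sumS X i).
  have /= Ai := At i (ltnSn j); apply: le_trans Ai _.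
  by rewrite lerD2l lerN2 lerDr.
have a1 : pr P [set t | no_jump_set (x - M) x (X i t, partial_sum X i t)] <=
    e / 2 * tail F x.
  rewrite joint_law; last exact: measurable_no_jump_set.
  have HC' z : pr (partial_sum_law i) [set s | z < s] <= C * tail F z by exact: HC.
  apply: le_trans (compare_no_jump (ltW C0) HC' _ _) _.
  rewrite -/(no_jump F M x) (_ : x - (x - M) = M); last by rewrite opprB addrC subrK.
  have -> : e / 2 * tail F x =
      C * (e / (4 * C) * tail F x + e / (4 * C) * tail F x).
    by field; rewrite gt_eqF.
  by rewrite ler_wpM2l ?(ltW C0)// lerD// mulrC.
have a2 : pr P (all_le j (x - M - K) `&` [set t | x - M < partial_sum X j t]) <=
    e / 2 * tail F x.
  apply: (le_trans H4).
  have -> : e / 2 * tail F x = e / (2 * D) * (D * tail F x).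
    by field; rewrite gt_eqF.
  by rewrite ler_wpM2l// ltW.
lra.
Qed.

Lemma rv_max_gt c t : (c%:E < rv_max X t)%E <-> exists i, c < X i t.
Proof.
rewrite /rv_max; split=> [H|[i ci]].
  apply: contrapT => /forallNP Hi; move: H; apply/negP; rewrite -leNgt.
  apply: bigmax_le => [|i _]; first by rewrite leNye.
  by rewrite lee_fin leNgt; apply/negP; exact: Hi.
by apply: (lt_le_trans _ (le_bigmax _ _ i)); rewrite lte_fin.
Qed.

Lemma measurable_rv_max_gt c : measurable [set t | (c%:E < rv_max X t)%E].
Proof.
rewrite (_ : mkset _ = ~` all_le n c); first by apply/measurableC/measurable_all_le.
apply/seteqP; split => t /=.
  move=> /rv_max_gt[i ci] /(_ i); rewrite /= ltn_ord => /(_ isT).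
  by rewrite leNgt ci.
move=> H; apply/rv_max_gt; apply: contrapT => /forallNP Hi; apply: H => i _ /=.
by rewrite leNgt; apply/negP; exact: Hi.
Qed.

Lemma big_jump_ratio_ge e : (0 < n)%N -> 0 < e -> exists K0, forall K, K0 <= K ->
  \forall x \near +oo, 1 - e <= big_jump_ratio X K x.
Proof.
move=> n0 e0; have [K0 K00 HK] := partial_sum_no_jump (leqnn n) e0.
exists K0 => K KK0; apply: filterS2 HK (near_ge 0) => x Hx x0.
have mU : measurable [set t | x < rv_sum X t].
  by apply: measurable_gtr; apply: measurable_sum => i; exact: mX.
have mA := measurable_rv_max_gt.
have S0 : 0 < pr P [set t | x < rv_sum X t].
  apply: lt_le_trans (rv_sum_ge_tail cF XF (Ordinal n0) x0); exact: tail_gt0.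
rewrite /big_jump_ratio -/(pr P [set t | x < rv_sum X t]) ler_pdivlMr//.
rewrite -/(pr P [set t | ((x - K)%:E < rv_max X t)%E /\ x < rv_sum X t]).
have mI : measurable [set t | ((x - K)%:E < rv_max X t)%E /\ x < rv_sum X t].
  by have := measurableI _ _ (mA (x - K)) mU.
rewrite mulrBl mul1r lerBlDr.
have mL := measurable_all_le n (x - K0).
apply: (@le_trans _ _ (pr P [set t | ((x - K)%:E < rv_max X t)%E /\ x < rv_sum X t]
   + pr P (all_le n (x - K0) `&` [set t | x < partial_sum X n t]))).
  apply: pr_leD => //.
    by apply: measurableI => //; apply: measurable_gtr; exact: mS.
  move=> t /= xt; have [|H] := pselect ((x - K)%:E < rv_max X t)%E; [by left|right].
  split=> /=; last by rewrite partial_sumn.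
  move=> i _ /=; have : ~ (x - K < X i t) by move=> xi; apply/H/rv_max_gt; exists i.
  move/negP; rewrite -leNgt => /le_trans; apply.
  by rewrite lerD2l lerN2.
rewrite lerD2l (le_trans Hx)// ler_wpM2l ?(ltW e0)//.
exact: (rv_sum_ge_tail cF XF (Ordinal n0)).
Qed.

Lemma big_jump_ratio_le1 K x : big_jump_ratio X K x <= 1.
Proof.
have mU : measurable [set t | x < rv_sum X t].
  by apply: measurable_gtr; apply: measurable_sum => i; exact: mX.
have [S0|S0] := eqVneq (pr P [set t | x < rv_sum X t]) 0.
  by rewrite /big_jump_ratio -/(pr P [set t | x < rv_sum X t]) S0 invr0 mulr0.
have S1 : 0 < pr P [set t | x < rv_sum X t] by rewrite lt_neqAle eq_sym S0 pr_ge0.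
rewrite /big_jump_ratio -/(pr P [set t | x < rv_sum X t]) ler_pdivrMr// mul1r.
apply: pr_le => //; last by move=> t [].
by have := measurableI _ _ (measurable_rv_max_gt (x - K)) mU.
Qed.
End single_jump_iid.

(** The exceptional event of [n] summands is controlled by the induction above, and
    the sum has at least the tail of one summand. *)
Lemma single_jump_classJ (R : realType) (F : df R) :
  classF R F -> single_jump F -> classJ R F.
Proof.
move=> cF sjF; split => // n n2 d T P X XF; apply: limf_einf_cvg1.
  by move=> K x; exact: big_jump_ratio_le1.
by move=> e e0; exact: (big_jump_ratio_ge cF XF sjF (ltnW n2) e0).
Qed.

(** * Independent variables on the plane *)

Section two_coordinates.
Context {R : realType}.
Variable F : df R.

Definition coordinate (i : 'I_2) (p : R * R) : R := if i == ord0 then p.1 else p.2.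

Lemma measurable_coordinate i : measurable_fun setT (coordinate i).
Proof.
by rewrite /coordinate; case: (i == ord0); [exact: measurable_fst|exact: measurable_snd].
Qed.

Definition coordinate_rv (i : 'I_2) : {RV (pair_law F) >-> R} :=
  HB.pack_for {mfun (R * R)%type >-> R} (coordinate i)
    (isMeasurableFun.Build _ _ _ _ _ (measurable_coordinate i)).

Lemma pr_coordinate i B : measurable B ->
  pr (pair_law F) (coordinate i @^-1` B) = pr (law F) B.
Proof.
move=> mB; rewrite /coordinate; case: (i == ord0).
  rewrite -[RHS]mulr1 -(prT (law F)) -(pr_prodX _ _ mB measurableT).
  by congr pr; apply/seteqP; split => p /=; [|case].
rewrite -[RHS]mul1r -(prT (law F)) -(pr_prodX _ _ measurableT mB).
by congr pr; apply/seteqP; split => p /=; [|case].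
Qed.

(** The class J quantifies over all probability spaces; its hypothesis is exploited
    on the plane with the product law. *)
Lemma coordinate_iid : iid coordinate_rv F.
Proof.
split=> [i x|J B mB].
  have mx : measurable `]-oo, x]%classic by exact: measurable_itv.
  rewrite /cdf -prE//.
  rewrite -[X in X%:E]/(pr (pair_law F) (coordinate i @^-1` `]-oo, x])).
  by rewrite pr_coordinate// set_itvNyc law_le.
pose C i := if i \in J then B i else setT.
have mC i : measurable (C i) by rewrite /C; case: ifP.
rewrite -/(pr (pair_law F) _).
have -> : \bigcap_(i in [set` J]) coordinate_rv i @^-1` B i =
    C ord0 `*` C (lift ord0 ord0).
  apply/seteqP; split => p /=.
    move=> H; split; rewrite /C; case: ifP => // iJ; first exact: (H ord0 iJ).
    exact: (H _ iJ).
  move=> [C0 C1] i /= iJ; rewrite /coordinate; case: (unliftP ord0 i) => [k ki|i0].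
    by move: C1; rewrite /C ki in iJ *; rewrite (ord1 k) in iJ *; rewrite iJ.
  by move: C0; rewrite /C i0 in iJ *; rewrite iJ.
rewrite (pr_prodX _ _ (mC _) (mC _)) big_mkcond/= big_ord_recl big_ord_recl big_ord0 mulr1 /C.
by congr (_ * _); case: ifP => iJ; rewrite ?prT//; exact/esym/pr_coordinate.
Qed.

Lemma classJ_no_jump : classJ R F -> forall e, 0 < e -> exists2 K, 0 <= K &
  \forall x \near +oo, no_jump F K x <= e * tail (nconv F 2) x.
Proof.
move=> [cF JF] e e0.
have [K K0 HK] := cvg1_limf_einf (JF 2 (leqnn 2) _ _ _ _ coordinate_iid) e0.
exists K => //; apply: filterS HK => x.
have sumE : [set p | x < rv_sum coordinate_rv p] = [set p : R * R | x < p.1 + p.2].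
  by apply/seteqP; split => p /=; rewrite /rv_sum !big_ord_recl big_ord0 addr0.
have mS := measurable_sum_gt x.
have jumpE : [set p | ((x - K)%:E < rv_max coordinate_rv p)%E /\
                      x < rv_sum coordinate_rv p] =
    [set p | x < p.1 + p.2] `&` ~` no_jump_set (x - K) x.
  apply/seteqP; split => p.
    move=> [/rv_max_gt[i xi]]; rewrite /rv_sum !big_ord_recl big_ord0 addr0 => xp.
    split=> // -[p1 p2 _]; move: xi; apply/negP; rewrite -leNgt.
    by rewrite /= /coordinate; case: ifP.
  move=> [xp Np]; split; last by rewrite /rv_sum !big_ord_recl big_ord0 addr0.
  apply/rv_max_gt; apply: contrapT => /forallNP H; apply: Np; split => //.
    by have /negP := H ord0; rewrite -leNgt.
  by have /negP := H (lift ord0 ord0); rewrite -leNgt.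
have := pr_setID (pair_law F) mS (measurable_no_jump_set (x - K) x).
rewrite (_ : _ `&` no_jump_set _ _ = no_jump_set (x - K) x); last first.
  by apply/seteqP; split => p; [case|move=> Np; split => //; case: Np].
rewrite -/(no_jump F K x) -tail_nconv2 => splitE.
rewrite /big_jump_ratio -/(pr (pair_law F) _) jumpE sumE -/(pr (pair_law F) _).
rewrite -tail_nconv2; set G := tail _ _ in splitE *.
have [G0 _|G0] := eqVneq G 0.
  by move: splitE; rewrite G0 mulr0; have := no_jump_ge0 F K x; have := pr_ge0 (pair_law F) ([set p | x < p.1 + p.2] `&` ~` no_jump_set (x - K) x); lra.
rewrite ler_pdivlMr; last by rewrite lt_neqAle eq_sym G0 tail_nconv_ge0.
lra.
Qed.

(** The bound relative to the tail of the sum, for the constant 1/2, first shows that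
    this tail is at most [4 * tail F (x - K)]; then the rectangle estimate makes it
    comparable with [tail F x]. *)
Lemma classJ_single_jump : classJ R F -> single_jump F.
Proof.
move=> JF; have [cF _] := JF.
have h0 : 0 < 2^-1 :> R by rewrite invr_gt0.
have [K K0 HK] := classJ_no_jump JF h0.
have H2 : \forall x \near +oo, no_jump F K x <= 2 * tail F (x - K).
  by apply: filterS HK => x; have := tail_nconv2_le F K x; lra.
have [C C0 HC] := no_jump_tail_shift cF (ltr0n _ 2) H2 K.
have GC : \forall x \near +oo, tail (nconv F 2) x <= 4 * C * tail F x.
  apply: filterS3 HK HC (near_ge 0) => x HK HC _.
  by have := tail_nconv2_le F K x; lra.
move=> e e0; have e4 : 0 < e / (4 * C) by rewrite divr_gt0// mulr_gt0.
have [L L0 HL] := classJ_no_jump JF e4; exists L => //.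
apply: filterS2 GC HL => x GC /le_trans; apply.
have -> : e * tail F x = e / (4 * C) * (4 * C * tail F x) by field; rewrite gt_eqF.
by rewrite ler_wpM2l// ltW.
Qed.
End two_coordinates.

(** * Dominated variation and subexponentiality *)

Section classes_OS_D.
Context {R : realType}.
Implicit Types F : df R.

Lemma single_jump_classOS F : classF R F -> single_jump F -> classOS R F.
Proof.
move=> cF sjF; split => //; have [C C0 HC] := tail_nconv2_bound cF sjF.
apply: (@limf_esup_le _ _ C); apply: filterS HC => x.
by rewrite ler_pdivrMr// tail_gt0.
Qed.

(** Without a jump, one summand exceeds [x / 2] and the other one exceeds [K]. *)
Lemma no_jump_le_half F K x : no_jump F K x <= 2 * (tail F K * tail F (x / 2)).
Proof.
have mgt y : measurable [set z : R | y < z] by exact: measurable_gtr.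
rewrite mulr_natl mulr2n {1}mulrC -!law_gt -!pr_prodX//.
apply: pr_leD; [exact: measurable_no_jump_set|exact: measurableX..|].
move=> p [p1 p2 xp]; have [p12|p12] := ltP (x / 2) p.1; [left|right]; split => //=; lra.
Qed.

Lemma classD_single_jump F : classD R F -> single_jump F.
Proof.
move=> [cF DF] e e0.
have h : 0 < (2^-1 : R) < 1 by rewrite invr_gt0 ltr0n/= invf_lt1// ltr1n.
have [C C0 HC] := limf_esup_lty (DF _ h).
have eC : 0 < e / (2 * C) by rewrite divr_gt0// mulr_gt0.
have [K K0 tK] := pinfty_ex_ge (num_real (0 : R)) (tail_small F eC).
exists K => //; apply: filterS HC => x; rewrite ler_pdivrMr ?tail_gt0// => HC.
apply: le_trans (no_jump_le_half F K x) _.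
have -> : e * tail F x = 2 * (e / (2 * C) * (C * tail F x)) by field; rewrite gt_eqF.
by rewrite ler_wpM2l// ler_pM ?tail_ge0.
Qed.
End classes_OS_D.

Section subexponential.
Context {R : realType}.
Variable F : df R.
Hypothesis cF : classF R F.

Lemma tail_nconv_lt0 n x : x < 0 -> tail (nconv F n) x = 1.
Proof.
elim: n x => [|n IH] x x0; first by rewrite /tail /= leNgt x0 subr0.
rewrite tail_nconvS -(int_pos_part cF (bmf_tail_nconv F n x)).
rewrite -[RHS](int_cst (law F) 1); apply: eq_Rintegral => y _; rewrite IH//.
by rewrite subr_lt0 (lt_le_trans x0)// le_max lexx orbT.
Qed.

(** The last summand lies below [y], between [y] and [x], or beyond [x]; the other
    ones have to exceed [x], [x - y] and a negative number. *)
Lemma tail_nconvS_ge n x y : 0 <= y <= x ->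
  tail (nconv F n) x * F y + tail (nconv F n) (x - y) * (tail F y - tail F x) +
  tail F x <= tail (nconv F n.+1) x.
Proof.
case/andP=> y0 yx; pose G := tail (nconv F n).
have mle : measurable [set z : R | z <= y] by exact: measurable_ler.
have moc : measurable [set z : R | y < z <= x].
  by rewrite -set_itvoc; exact: measurable_itv.
have mgt : measurable [set z : R | x < z] by exact: measurable_gtr.
have b1 := bmfZ (G x) (bmf_indic R mle).
have b2 := bmfZ (G (x - y)) (bmf_indic R moc).
have b3 := bmf_indic R mgt.
have bG := bmf_tail_nconv F n x.
rewrite tail_nconvS -(int_pos_part cF bG).
rewrite -(law_le F) -law_oc// -[X in _ + X]law_gt.
rewrite -!int_indic// -!intZ -?intD//; try exact: bmf_indic; try exact: bmfD.
apply: le_int => [||z].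
- by apply: bmfD => //; exact: bmfD.
- case: bG => mG [M GM]; split; last by exists M => z; exact: GM.
  by apply: (measurableT_comp mG); exact: measurable_maxr.
rewrite !indic_set; have G0 u : 0 <= G u by exact: tail_nconv_ge0.
have Gni u v : u <= v -> G v <= G u by exact: tail_nconv_ni.
have [zy|zy] := leP z y.
  rewrite ltNge (le_trans zy yx) /= mulr1 mulr0 !addr0; apply: Gni.
  by rewrite gerBl le_max lexx orbT.
have [zx|zx] := leP z x.
  rewrite /= mulr1 mulr0 add0r addr0; apply: Gni.
  by rewrite lerD2l lerN2 le_max (ltW zy).
rewrite /= !mulr0 !add0r -/(G _) /G tail_nconv_lt0//.
by rewrite subr_lt0 lt_max zx.
Qed.

(** The assumed bound is integrated where the last summand leaves at least [x0] to
    the others. The term [- tail F x] accounts for the last summand exceeding [x],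
    which the convolution counts with full weight. *)
Lemma tail_nconvS_le n c x0 x : 0 <= x0 -> 0 <= c ->
  (forall z, x0 <= z -> tail (nconv F n) z <= c * tail F z) ->
  tail (nconv F n.+1) x <= c * (tail (nconv F 2) x - tail F x) + tail F (x - x0).
Proof.
move=> x00 c0 Hc.
have mgt y : measurable [set z : R | y < z] by exact: measurable_gtr.
rewrite [tail (nconv F 2) x]tail_nconvS tail_nconv1.
have b1 := bmf_tail_nconv F 1 x; rewrite tail_nconv1 in b1.
have b0 := bmf_indic R (mgt x); have b2 := bmfZ (- 1) b0.
have b3 := bmf_indic R (mgt (x - x0)).
have b12 := bmfZ c (bmfD b1 b2).
rewrite -(law_gt F x) -(law_gt F (x - x0)) -!int_indic//.
rewrite -[X in _ * (_ + X)]mulN1r -!intZ//.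
rewrite -intD// -intZ; last exact: bmfD.
rewrite -intD// tail_nconvS; apply: le_int => [||y].
- exact: bmf_tail_nconv.
- exact: bmfD.
rewrite !indic_set.
have [yx|yx] := ltP x y.
  have -> /= : x - x0 < y by apply: le_lt_trans yx; rewrite gerBl.
  by rewrite mulr1 tail_lt0 ?subr_lt0// subrr mulr0 add0r tail_nconv_le1.
rewrite mulr0 addr0; have [yx0|yx0] := ltP (x - x0) y.
  rewrite /= (le_trans (tail_nconv_le1 _ _ _))//= lerDr mulr_ge0//; exact: tail_ge0.
by rewrite addr0; apply: Hc; rewrite lerBrDl -lerBrDr.
Qed.

Lemma ratio_translate (f : R -> R) (l a : R) :
  f x @[x --> +oo] --> l -> f (x + a) @[x --> +oo] --> l.
Proof. by move=> fl A /fl; exact: near_translate. Qed.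

Let t0 x : tail F x != 0. Proof. by rewrite gt_eqF// tail_gt0. Qed.

Lemma df_cvg1 : F x @[x --> +oo] --> (1 : R).
Proof. exact: cumulativey. Qed.

(** The upper bound is the one for [n] summands convolved once more, except on the
    bounded set where it fails. *)
Lemma nconv_ratio_cvg n :
  (forall a, tail F (x - a) / tail F x @[x --> +oo] --> (1 : R)) ->
  tail (nconv F 2) x / tail F x @[x --> +oo] --> (2 : R) ->
  tail (nconv F n.+1) x / tail F x @[x --> +oo] --> (n.+1%:R : R).
Proof.
move=> HL H2; elim: n => [|n IH].
  rewrite tail_nconv1; apply: cvg_near_cst; near=> x.
  by apply/eqP; rewrite divff.
apply/cvgrPdist_le => e e0.
have e2 : 0 < e / 2 by rewrite divr_gt0.
have low : (tail (nconv F n.+1) x / tail F x) * F x + 1 @[x --> +oo] --> (n.+2%:R : R).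
  have -> : n.+2%:R = n.+1%:R * 1 + 1 :> R by rewrite mulr1 natr1.
  by apply: cvgD; [apply: cvgM => //; exact: df_cvg1|exact: cvg_cst].
pose c : R := n.+1%:R + e / 2.
have c0 : 0 <= c by rewrite addr_ge0// ltW.
have [x0 x00 Hc] : exists2 x0, 0 <= x0 & forall z, x0 <= z ->
    tail (nconv F n.+1) z <= c * tail F z.
  have /cvgrPdist_le/(_ _ e2)[M [_ HM]] := IH.
  exists (Num.max 0 (M + 1)); first by rewrite le_max lexx.
  move=> z; rewrite ge_max => /andP[_ Mz].
  have /HM : M < z by apply: lt_le_trans Mz; rewrite ltrDl.
  rewrite ler_norml => /andP[Hz _]; rewrite -ler_pdivrMr ?tail_gt0//.
  by move: Hz; rewrite /c; lra.
have up : c * (tail (nconv F 2) x / tail F x - 1) + tail F (x - x0) / tail F x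
    @[x --> +oo] --> c * (2 - 1) + 1.
  apply: cvgD (HL x0); apply: cvgM; first exact: cvg_cst.
  by apply: cvgB => //; exact: cvg_cst.
have /cvgrPdist_le/(_ _ e0) Hlow := low.
have /cvgrPdist_le/(_ _ e2) Hup := up.
apply: filterS3 Hlow Hup (near_ge 0) => x Hl Hu x0'.
have tx : 0 < tail F x by exact: tail_gt0.
have G1 : tail (nconv F n.+1) x / tail F x * F x + 1 <=
    tail (nconv F n.+2) x / tail F x.
  have xx : 0 <= x <= x by rewrite x0' lexx.
  rewrite ler_pdivlMr// mulrDl mul1r mulrAC mulfVK//.
  by have := tail_nconvS_ge n.+1 xx; rewrite !subrr mulr0 addr0.
have G2 : tail (nconv F n.+2) x / tail F x <=
    c * (tail (nconv F 2) x / tail F x - 1) + tail F (x - x0) / tail F x.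
  rewrite ler_pdivrMr// mulrDl mulfVK// -mulrA mulrBl mulfVK// mul1r.
  exact: tail_nconvS_le.
have cE : c * (2 - 1) + 1 = n.+2%:R + e / 2.
  by rewrite /c -[n.+2%:R]natr1; ring.
rewrite cE in Hu; move: G1 G2 Hl Hu; rewrite !ler_norml.
move: (_ * F x + 1) (tail (nconv F n.+2) x / _) (c * _ + _) (n.+2%:R : R) => l r u N.
by clear => lr ru /andP[_ Hl] /andP[Hu _]; apply/andP; split; lra.
Unshelve. all: by end_near. Qed.

Lemma classL_shift : classL R F ->
  forall a, tail F (x - a) / tail F x @[x --> +oo] --> (1 : R).
Proof.
move=> [_ LF] a; have [->|a0] := eqVneq a 0; last by apply: LF; rewrite oppr_eq0.
by apply: cvg_near_cst; near=> x; rewrite subr0; apply/eqP; rewrite divff.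
Unshelve. all: by end_near. Qed.

(** For a long-tailed law the jump beyond [x - K] has asymptotically the same
    probability as the jump beyond [x]. *)
Lemma single_jump_classS : single_jump F -> classL R F -> classS R F.
Proof.
move=> sjF LF; split => // -[//|n] n1; apply: nconv_ratio_cvg.
  exact: classL_shift.
apply/cvgrPdist_le => e e0.
have e2 : 0 < e / 2 by rewrite divr_gt0.
have e4 : 0 < e / 4 by rewrite divr_gt0.
have [K K0 HK] := sjF _ e2.
have /cvgrPdist_le/(_ _ e4) HL := classL_shift LF K.
have H0 : \forall x \near +oo, tail F x <= e /\ 0 <= x.
  by apply: filterI; [exact: tail_small|exact: near_ge].
apply: filterS3 HK HL H0 => x HK HL [Ht x0].
have tx : 0 < tail F x by exact: tail_gt0.
have xx : 0 <= x <= x by rewrite x0 lexx.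
have G1 : 2 * tail F x - tail F x * tail F x <= tail (nconv F 2) x.
  have := tail_nconvS_ge 1 xx; rewrite tail_nconv1 !subrr mulr0 addr0 df_tail; lra.
have G2 := le_trans (tail_nconv2_le F K x) (lerD HK (lexx _)).
have HL' : tail F (x - K) <= (1 + e / 4) * tail F x.
  by rewrite -ler_pdivrMr//; move: HL; rewrite ler_norml; lra.
have te : tail F x * tail F x <= e * tail F x by rewrite ler_wpM2r// ltW.
have r1 : tail (nconv F 2) x / tail F x <= 2 + e by rewrite ler_pdivrMr//; lra.
have r2 : 2 - e <= tail (nconv F 2) x / tail F x by rewrite ler_pdivlMr//; lra.
by rewrite ler_norml; lra.
Qed.

(** The case of two summands bounds [tail F (x - y) / tail F x] from above by a
    quantity that tends to 1. *)
Lemma classS_classL : classS R F -> classL R F.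
Proof.
move=> [_ /(_ 2 (leqnn 2)) H2]; split => //.
have pos y : 0 < y -> tail F (x - y) / tail F x @[x --> +oo] --> (1 : R).
  move=> y0; have ty : 0 < tail F y by exact: tail_gt0.
  pose u x := (tail (nconv F 2) x / tail F x - F y - 1) / (tail F y - tail F x).
  have ul : u x @[x --> +oo] --> (1 : R).
    have -> : (1 : R) = (2 - F y - 1) / (tail F y - 0).
      by rewrite df_tail; field; rewrite gt_eqF// subr0.
    apply: cvgM; first by apply: cvgB; [apply: cvgB|]; rewrite //; exact: cvg_cst.
    apply: cvgV; first by rewrite subr0 gt_eqF.
    by apply: cvgB; [exact: cvg_cst|exact: tail_cvg0].
  apply: (squeeze_cvgr _ (cvg_cst (1 : R)) ul).
  have ty2 : 0 < tail F y / 2 by rewrite divr_gt0.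
  apply: filterS2 (tail_small F ty2) (near_ge y) => x tx yx.
  have tx0 : 0 < tail F x by exact: tail_gt0.
  apply/andP; split.
    by rewrite ler_pdivlMr// mul1r tail_ni// gerBl ltW.
  rewrite /u ler_pdivlMr; last by rewrite subr_gt0 (le_lt_trans tx)//; lra.
  have := @tail_nconvS_ge 1 x y; rewrite tail_nconv1 (ltW y0) yx => /(_ isT) H.
  rewrite mulrAC ler_pdivrMr//.
  have -> : (tail (nconv F 2) x / tail F x - F y - 1) * tail F x =
    tail (nconv F 2) x - tail F x * F y - tail F x by field.
  by move: H; lra.
move=> y; rewrite neq_lt => /orP[y0|y0].
  by have := pos (- y); rewrite opprK oppr_gt0; exact.
have := ratio_translate y (pos y y0) => H.
rewrite -[X in _ --> X](invr1 R).
apply: cvg_trans (cvgV _ H); last by rewrite oner_neq0.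
apply: near_eq_cvg; near=> x => /=.
by rewrite addrK invf_div.
Unshelve. all: by end_near. Qed.

(** The event that a summand exceeds [x] has probability asymptotic to
    [2 * tail F x], so it exhausts the tail of the sum even with [K = 0]. *)
Lemma classS_single_jump : classS R F -> single_jump F.
Proof.
move=> [_ /(_ 2 (leqnn 2)) H2] e e0; exists 0 => //.
have e2 : 0 < e / 2 by rewrite divr_gt0.
have /cvgrPdist_le/(_ _ e2) := H2.
apply: filterS3 (tail_small F e2) (near_ge 0) => x Ht x0.
have tx0 : 0 < tail F x by exact: tail_gt0.
rewrite ler_norml => /andP[H _].
have := tail_nconv2_ge cF (lexx 0) x0.
have : tail (nconv F 2) x <= (2 + e / 2) * tail F x.
  by rewrite -ler_pdivrMr//; lra.
have : tail F x * tail F x <= e / 2 * tail F x by rewrite ler_wpM2r// ltW.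
by rewrite expr2; lra.
Qed.
End subexponential.

(** * Tails of exponential rate *)

(** Dominated convergence for a real parameter, by reduction to sequences. *)
Lemma int_cvg d (T : measurableType d) (R : realType) (P : probability T R)
    (r : R -> T -> R) (f : T -> R) (C : R) :
  (forall x, measurable_fun setT (r x)) -> (forall x t, `|r x t| <= C) ->
  (forall t, r x t @[x --> +oo] --> f t) ->
  \int[P]_t r x t @[x --> +oo] --> \int[P]_t f t.
Proof.
move=> mr rC rf; apply/cvg_pinftyP => u uoo.
have bC := bmf_cst T C.
have h : (\int[P]_t (r (u k) t)%:E)%E @[k --> \oo] --> (\int[P]_t (f t)%:E)%E.
  apply: (@dominated_cvg _ _ _ P setT measurableT (fun k t => (r (u k) t)%:E)
    (EFin \o f) (EFin \o cst C)) => //.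
  - by move=> k; apply/measurable_EFinP; exact: mr.
  - move=> t _; apply/fine_cvgP; split; first by near=> k.
    by have /cvg_pinftyP := rf t; exact.
  - exact: bmfP.
  - by move=> k t _; rewrite lee_fin.
have bf : bounded_measurable f.
  split; last first.
    exists C => t; have : `|r x t| @[x --> +oo] --> `|f t| by exact: cvg_norm.
    by move=> H; apply: (cvgr_to_le H); near=> x.
  apply: (@measurable_fun_cvg _ _ _ _ (fun k => r k%:R)) => //.
  move=> t _; have /cvg_pinftyP := rf t; apply.
  exact: cvgr_idn.
rewrite -(int_EFin P bf) in h.
exact: fine_cvg h.
Unshelve. all: by end_near. Qed.

Section truncated_mgf.
Context {R : realType}.
Implicit Types (F : df R) (g K : R).

Definition mgf_trunc F g K : R := \int[law F]_y expR (g * Num.min y K).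

Lemma bmf_exp_min g K : 0 <= g ->
  bounded_measurable (fun y : R => expR (g * Num.min y K)).
Proof.
move=> g0; split; last first.
  exists (expR (g * K)) => y; rewrite ger0_norm ?expR_ge0// ler_expR ler_wpM2l//.
  by rewrite ge_min lexx orbT.
apply: measurableT_comp => //; apply: measurable_funM => //.
exact: measurable_minr.
Qed.

Lemma mgf_trunc_nd F g : 0 <= g -> {homo mgf_trunc F g : K L / K <= L}.
Proof.
move=> g0 K L KL; apply: le_int; [exact: bmf_exp_min..|] => y.
by rewrite ler_expR ler_wpM2l// le_min !ge_min lexx KL orbT.
Qed.

Definition jump_set (K x : R) : set (R * R) := [set p | x - K < p.2 /\ x < p.1 + p.2].

Lemma measurable_jump_set K x : measurable (jump_set K x).
Proof.
exact: measurableI _ _ (measurable_snd_gt (x - K)) (measurable_sum_gt x).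
Qed.

(** The two constraints [x - K < v] and [x < y + v] on the second summand merge into
    [x - min (y, K) < v]. *)
Lemma pr_jump_set F K x :
  pr (pair_law F) (jump_set K x) = \int[law F]_y tail F (x - Num.min y K).
Proof.
rewrite pr_section; last exact: measurable_jump_set.
apply: eq_Rintegral => y _; rewrite -law_gt; congr pr; apply/seteqP.
have E z : (x - Num.min y K < z) = (x - K < z) && (x < y + z).
  by rewrite ltrBlDr -ltrBlDl lt_min !ltrBlDl (addrC K) (addrC y) andbC.
by split => z; rewrite /jump_set/= E; [case=> -> ->|case/andP].
Qed.

(** Inclusion-exclusion for the summand that exceeds [x - K]. *)
Lemma tail_nconv2_jump F K x :
  0 <= no_jump F K x + 2 * pr (pair_law F) (jump_set K x) - tail (nconv F 2) x
    <= tail F (x - K) ^+ 2.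
Proof.
pose A : set (R * R) := [set p | jump_set K x (p.2, p.1)].
have mB := measurable_jump_set K x.
have mA : measurable A.
  rewrite (_ : A = [set p | x - K < p.1] `&` [set p | x < p.1 + p.2]).
    by apply: measurableI; [exact: measurable_fst_gt|exact: measurable_sum_gt].
  by apply/seteqP; split => p [/= ? ?]; split => //=; rewrite addrC.
have pA : pr (pair_law F) A = pr (pair_law F) (jump_set K x) by exact: pr_swap.
have mN := measurable_no_jump_set (x - K) x.
have mAB : measurable (A `&` jump_set K x) by exact: measurableI.
have E : tail (nconv F 2) x = no_jump F K x + pr (pair_law F) (A `|` jump_set K x).
  have N0 : no_jump_set (x - K) x `&` (A `|` jump_set K x) = set0.
    apply/seteqP; split => // p [[p1 p2 _] [[/=]|[/=]]].
      by rewrite ltNge p1.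
    by rewrite ltNge p2.
  rewrite tail_nconv2 /no_jump -(prU _ mN (measurableU _ _ mA mB) N0).
  congr pr; apply/seteqP; split => p /=.
    move=> xp; have [p1|p1] := ltP (x - K) p.1.
      by right; left; split => //=; rewrite addrC.
    by have [p2|p2] := ltP (x - K) p.2; [right; right|left].
  by move=> [[]//|[[/= _]|[/= _]]//]; rewrite addrC.
have AB : pr (pair_law F) (A `&` jump_set K x) <= tail F (x - K) ^+ 2.
  rewrite -pair_both_gt; apply: pr_le => //.
    by apply: measurableI; [exact: measurable_fst_gt|exact: measurable_snd_gt].
  by move=> p [[/= ? _] [/= ? _]].
have := pr_ge0 (pair_law F) (A `&` jump_set K x).
rewrite E (prU2 _ mA mB) pA; move: AB.
move: (pr _ (A `&` _)) (pr _ (jump_set K x)) (no_jump F K x) (tail F (x - K)).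
by clear => *; lra.
Qed.
End truncated_mgf.

Section light_tails.
Context {R : realType}.
Variables (F : df R) (g : R).
Hypotheses (g0 : 0 <= g) (LF : classLg g F).

Let cF : classF R F. Proof. by case: LF. Qed.
Let t0 x : tail F x != 0. Proof. by rewrite gt_eqF// tail_gt0. Qed.

Lemma classLg_shift a : tail F (x - a) / tail F x @[x --> +oo] --> expR (g * a).
Proof. by have := LF.2 (- a); rewrite mulrNN. Qed.

(** As [x] grows, [tail F (x - min (y, K)) / tail F x] tends to
    [exp (g min (y, K))] and is dominated by its value at [y = K]. *)
Lemma jump_set_ratio K :
  pr (pair_law F) (jump_set K x) / tail F x @[x --> +oo] --> mgf_trunc F g K.
Proof.
have C0 : expR (g * K) < expR (g * K) + 1 by rewrite ltrDl.
have [M [_ HM]] := cvgr_le _ (@classLg_shift K) _ C0.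
set C := expR (g * K) + 1 in C0 HM.
pose r x y := if M < x then tail F (x - Num.min y K) / tail F x else 0.
have h : \int[law F]_y r x y @[x --> +oo] --> mgf_trunc F g K.
  apply: (@int_cvg _ _ _ (law F) r _ C).
  - move=> x; rewrite /r; case: (M < x); last exact: measurable_cst.
    apply: measurable_funM; last exact: measurable_cst.
    have mt : measurable_fun setT (tail F).
      by apply: nonincreasing_measurable => //; exact: tail_ni.
    apply: (measurableT_comp mt); apply: measurable_funB => //.
    exact: measurable_minr.
  - move=> x y; rewrite /r; case: ifPn => [Mx|_].
      rewrite ger0_norm ?divr_ge0 ?tail_ge0//; apply: le_trans (HM x Mx).
      rewrite ler_wpM2r ?invr_ge0 ?tail_ge0// tail_ni// lerD2l lerN2.
      by rewrite ge_min lexx orbT.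
    by rewrite normr0 addr_ge0// expR_ge0.
  - move=> y; apply: cvg_trans (@classLg_shift (Num.min y K)).
    apply: near_eq_cvg; have : \forall x \near +oo, M < x.
      by apply: nbhs_pinfty_gt; exact: num_real.
    by apply: filterS => x; rewrite /r => ->.
apply: cvg_trans h; apply: near_eq_cvg.
have : \forall x \near +oo, M < x by apply: nbhs_pinfty_gt; exact: num_real.
apply: filterS => x Mx; rewrite /r Mx pr_jump_set.
under eq_Rintegral do rewrite mulrC.
rewrite intZ 1?mulrC//; split; last first.
  by exists 1 => y; rewrite ger0_norm ?tail_ge0// tail_le1.
have mt : measurable_fun setT (tail F).
  by apply: nonincreasing_measurable => //; exact: tail_ni.
apply: (measurableT_comp mt); apply: measurable_funB => //.
exact: measurable_minr.
Qed.

Lemma nconv2_no_jump_ratio K :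
  (tail (nconv F 2) x - no_jump F K x) / tail F x @[x --> +oo] -->
  2 * mgf_trunc F g K.
Proof.
pose J x := pr (pair_law F) (jump_set K x) / tail F x.
have hi : 2 * J x @[x --> +oo] --> 2 * mgf_trunc F g K.
  by apply: cvgM; [exact: cvg_cst|exact: jump_set_ratio].
have lo : 2 * J x - tail F (x - K) / tail F x * tail F (x - K) @[x --> +oo] -->
    2 * mgf_trunc F g K.
  rewrite -[X in _ --> X]subr0 -[X in _ - X](mulr0 (expR (g * K))).
  apply: cvgB => //; apply: cvgM; first exact: classLg_shift.
  exact: ratio_translate (@tail_cvg0 _ F).
apply: (squeeze_cvgr _ lo hi); near=> x.
have tx : 0 < tail F x by exact: tail_gt0.
have /andP[H1 H2] := tail_nconv2_jump F K x.
rewrite [X in X <= _ <= _](_ : _ =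
    (2 * pr (pair_law F) (jump_set K x) - tail F (x - K) ^+ 2) / tail F x); last first.
  by rewrite /J; field.
have i0 : 0 <= (tail F x)^-1 by rewrite invr_ge0 ltW.
by rewrite /J mulrA; apply/andP; split; rewrite ler_wpM2r//; lra.
Unshelve. all: by end_near. Qed.

(** By the previous limit the convolution ratio is eventually within [e] of a constant
    depending on [K], so it is Cauchy; its limit need not be identified here. *)
Lemma single_jump_classSg : single_jump F -> classSg g F.
Proof.
move=> sjF; split => //.
have : cauchy ((fun x => tail (nconv F 2) x / tail F x) @ +oo).
  apply: cauchy_exP => e e0.
  have e2 : 0 < e / 2 by rewrite divr_gt0.
  have e4 : 0 < e / 4 by rewrite divr_gt0.
  have [K K0 HK] := sjF _ e4; exists (2 * mgf_trunc F g K).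
  have /cvgrPdist_le/(_ _ e2) := @nconv2_no_jump_ratio K.
  apply: filterS2 HK => x HK; have tx : 0 < tail F x by exact: tail_gt0.
  rewrite -ler_pdivrMr// in HK.
  have N0 : 0 <= no_jump F K x / tail F x by rewrite divr_ge0 ?no_jump_ge0// ltW.
  rewrite mulrBl ler_norml /ball/= ltr_norml; move: HK N0 => /=; lra.
move=> /cauchy_cvg; set l := lim _ => Hl.
have l1 : 1 <= l.
  apply: (cvgr_to_ge Hl); apply: filterS (near_ge 0) => x x0.
  have xx : 0 <= x <= x by rewrite x0 lexx.
  rewrite ler_pdivlMr ?tail_gt0// mul1r.
  have := tail_nconvS_ge cF 1 xx; rewrite tail_nconv1 !subrr mulr0 addr0.
  by have := mulr_ge0 (tail_ge0 F x) (df_ge0 F x); lra.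
exists (l / 2); first by rewrite divr_gt0// (lt_le_trans ltr01).
by rewrite mulrC divfK.
Qed.
End light_tails.

(** * Expectations of truncated exponentials *)

Lemma bmf_comp d1 d2 (T1 : measurableType d1) (T2 : measurableType d2) (R : realType)
    (f : T2 -> R) (h : T1 -> T2) :
  bounded_measurable f -> measurable_fun setT h -> bounded_measurable (f \o h).
Proof.
by move=> [mf [M fM]] mh; split; [exact: measurableT_comp mf mh|exists M => t; exact: fM].
Qed.

Lemma int_prod d1 d2 (T1 : measurableType d1) (T2 : measurableType d2) (R : realType)
    (mu : probability T1 R) (nu : probability T2 R) (f : T1 -> R) (h : T2 -> R) :
  bounded_measurable f -> bounded_measurable h ->
  (forall x, 0 <= f x) -> (forall y, 0 <= h y) ->
  \int[prod_prob mu nu]_p (f p.1 * h p.2) = \int[mu]_x f x * \int[nu]_y h y.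
Proof.
move=> bf bh f0 h0.
have b1 : bounded_measurable (fun p : T1 * T2 => f p.1 * h p.2).
  by apply: bmfM; apply: bmf_comp.
apply: EFin_inj; rewrite int_EFin//.
rewrite [LHS](@fubini_tonelli1 _ _ _ _ _ mu nu (fun p => (f p.1 * h p.2)%:E)); last 2 first.
- by apply/measurable_EFinP; case: b1.
- by move=> p; rewrite lee_fin mulr_ge0.
rewrite mulrC -intZ// int_EFin; last exact: bmfZ.
apply: eq_integral => x _; rewrite /fubini_F /= -int_EFin; last exact: bmfZ.
by rewrite intZ// mulrC.
Qed.

(** Comparison of expectations by integrating the tails. *)
Lemma le_int_tails d1 d2 (T1 : measurableType d1) (T2 : measurableType d2) (R : realType)
    (P : probability T1 R) (Q : probability T2 R) (X : T1 -> R) (Y : T2 -> R) (a : R) :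
  bounded_measurable X -> bounded_measurable Y -> 0 <= a ->
  (forall t, 0 <= X t) -> (forall t, 0 <= Y t) ->
  (forall r, 0 <= r -> a * pr Q [set t | r < Y t] <= pr P [set t | r < X t]) ->
  a * \int[Q]_t Y t <= \int[P]_t X t.
Proof.
move=> bX bY a0 X0 Y0 XY.
pose Xm : {RV P >-> R} := HB.pack_for {mfun T1 >-> R} X (isMeasurableFun.Build _ _ _ _ X bX.1).
pose Ym : {RV Q >-> R} := HB.pack_for {mfun T2 >-> R} Y (isMeasurableFun.Build _ _ _ _ Y bY.1).
rewrite -intZ// -lee_fin int_EFin; last exact: bmfZ.
rewrite int_EFin//.
have -> : (\int[P]_t (X t)%:E)%E = ('E_P[Xm])%E by rewrite expectation_def.
have bYi := bmfP Q bY.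
under eq_integral do rewrite EFinM.
rewrite integralZl//.
have -> : (\int[Q]_t (Y t)%:E)%E = ('E_Q[Ym])%E by rewrite expectation_def.
rewrite !ge0_expectation_ccdf// -ge0_integralZl//; last first.
  by apply: measurable_funTS; exact: ccdf_measurable.
apply: ge0_le_integral => //.
- by move=> r _; rewrite mule_ge0.
- apply: measurable_funTS; apply: emeasurable_funM; first exact: measurable_cst.
  exact: ccdf_measurable.
- by apply: measurable_funTS; exact: ccdf_measurable.
move=> r; rewrite /= in_itv/= andbT => r0.
have mX : measurable [set t | r < X t] by exact: measurable_gtr bX.1.
have mY : measurable [set t | r < Y t] by exact: measurable_gtr bY.1.
rewrite /ccdf /distribution /pushforward !set_itvoy.
by have := XY r r0; rewrite -lee_fin EFinM !prE.
Qed.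

Lemma min_subadd (R : realFieldType) (a c t : R) : 0 <= a -> 0 <= c -> 0 <= t ->
  Num.min (a + c) t <= Num.min a t + Num.min c t.
Proof.
by rewrite /Num.min; do 3 case: ifPn; rewrite -?leNgt; lra.
Qed.

Lemma min_half_superadd (R : realFieldType) (a c t : R) :
  0 <= a -> 0 <= c -> 0 <= t ->
  Num.min a (t / 2) + Num.min c (t / 2) <= Num.min (a + c) t.
Proof.
by rewrite /Num.min; do 3 case: ifPn; rewrite -?leNgt; lra.
Qed.

Section lower_limit.
Context {R : realType}.
Variables (F : df R) (g : R).
Hypotheses (cF : classF R F) (g0 : 0 <= g).

Definition exp_gap (l w : R) : R := expR (l * w) - expR (g * w).

(** The gap factors as [exp (g w) (exp ((l - g) w) - 1)], a product of two increasing
    functions. *)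
Lemma exp_gap_lt l w v : g < l -> 0 <= w < v -> exp_gap l w < exp_gap l v.
Proof.
move=> gl /andP[w0 wv].
have E z : exp_gap l z = expR (g * z) * (expR ((l - g) * z) - 1).
  by rewrite /exp_gap mulrBr mulr1 -expRD; congr (expR _ - _); ring.
rewrite !E; apply: (@le_lt_trans _ _ (expR (g * v) * (expR ((l - g) * w) - 1))).
  rewrite ler_wpM2r//; last by rewrite ler_expR ler_wpM2l// ltW.
  by rewrite subr_ge0 -expR0 ler_expR mulr_ge0// subr_ge0 ltW.
by rewrite ltr_pM2l ?expR_gt0// ltrD2r ltr_expR ltr_pM2l// subr_gt0.
Qed.

Lemma exp_gap_le l w v : g < l -> 0 <= w <= v -> exp_gap l w <= exp_gap l v.
Proof.
move=> gl /andP[w0]; rewrite le_eqVlt => /predU1P[->//|wv].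
by apply/ltW/exp_gap_lt; rewrite ?w0.
Qed.

Lemma exp_gap0 l : exp_gap l 0 = 0.
Proof. by rewrite /exp_gap !mulr0 subrr. Qed.

Let pos (y : R) : R := Num.max y 0.
Let sum_pos (p : R * R) : R := pos p.1 + pos p.2.

Let mpos : measurable_fun setT pos. Proof. exact: measurable_maxr. Qed.

Let msum_pos : measurable_fun setT sum_pos.
Proof.
by apply: measurable_funD; apply: (measurableT_comp mpos);
  [exact: measurable_fst|exact: measurable_snd].
Qed.

Let pos_ge0 y : 0 <= pos y. Proof. by rewrite le_max lexx orbT. Qed.

Lemma mgf_trunc_pos l t : 0 <= l ->
  \int[law F]_y expR (l * Num.min (pos y) t) = mgf_trunc F l t.
Proof. by move=> l0; apply: (int_pos_part cF (bmf_exp_min t l0)). Qed.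

(** Testing the two tails against [exp (l min (s, t)) - exp (g min (s, t))]: since
    [min (s, t)] is subadditive, its expectation over the sum is controlled by the
    one over a single summand. *)
Lemma mgf_trunc_ineq l b x0 t : g < l -> 0 <= b -> 0 <= x0 <= t ->
  (forall x, x0 <= x -> 2 * b * tail F x <= tail (nconv F 2) x) ->
  2 * b * (mgf_trunc F l t - mgf_trunc F g t - exp_gap l x0) <=
  mgf_trunc F l t ^+ 2 - mgf_trunc F g (t / 2) ^+ 2.
Proof.
move=> gl b0 /andP[x00 x0t] Hb.
have l0 : 0 <= l by rewrite (le_trans g0)// ltW.
have t0 : 0 <= t by exact: le_trans x0t.
have bl : bounded_measurable (fun s : R => expR (l * Num.min s t)) by exact: bmf_exp_min.
have bg : bounded_measurable (fun s : R => expR (g * Num.min s t)) by exact: bmf_exp_min.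
pose u (s : R) := expR (l * Num.min s t) + -1 * expR (g * Num.min s t).
have bu : bounded_measurable u by apply: bmfD => //; exact: bmfZ.
have uE s : u s = exp_gap l (Num.min s t) by rewrite /u mulN1r.
have w0 s : 0 <= s -> 0 <= Num.min s t by move=> s0; rewrite le_min s0.
have u0 s : 0 <= s -> 0 <= u s.
  by move=> s0; rewrite uE -(exp_gap0 l) exp_gap_le// lexx w0.
have gx0 : 0 <= exp_gap l x0 by rewrite -(exp_gap0 l) exp_gap_le// lexx.
pose v (s : R) := Num.max (u s - exp_gap l x0) 0.
have bv : bounded_measurable v.
  have [mu [M uM]] := bu; split.
    apply: measurable_maxr; last exact: measurable_cst.
    by apply: measurable_funB => //; exact: measurable_cst.
  exists (M + exp_gap l x0) => s; rewrite /v.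
  have := uM s; rewrite ler_norml => /andP[? ?].
  have : 0 <= M by exact: le_trans (uM s).
  by move=> M0; rewrite ger0_norm ?le_max ?lexx ?orbT// ge_max; lra.
have s0 p : 0 <= sum_pos p by rewrite addr_ge0.
have H1 : \int[pair_law F]_p u (sum_pos p) <=
    mgf_trunc F l t ^+ 2 - mgf_trunc F g (t / 2) ^+ 2.
  have b1 := bmf_comp bl msum_pos; have b2 := bmf_comp bg msum_pos.
  rewrite /u intD//; last exact: bmfZ.
  rewrite intZ// mulN1r; apply: lerB.
    rewrite expr2 -{1}mgf_trunc_pos// -mgf_trunc_pos// -int_prod//; try exact: bmf_comp bl mpos.
    apply: le_int => // [|p].
      apply: bmfM; apply: (bmf_comp (bmf_comp bl mpos)).
        exact: measurable_fst.
      exact: measurable_snd.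
    by rewrite -expRD -mulrDr ler_expR ler_wpM2l// min_subadd.
  have bg2 : bounded_measurable (fun s : R => expR (g * Num.min s (t / 2))).
    exact: bmf_exp_min.
  rewrite expr2 -{1}mgf_trunc_pos// -mgf_trunc_pos// -int_prod//; try exact: bmf_comp bg2 mpos.
  apply: le_int => // [|p].
    apply: bmfM; apply: (bmf_comp (bmf_comp bg2 mpos)).
      exact: measurable_fst.
    exact: measurable_snd.
  by rewrite -expRD -mulrDr ler_expR ler_wpM2l// min_half_superadd.
have H2 : \int[pair_law F]_p v (sum_pos p) <= \int[pair_law F]_p u (sum_pos p).
  apply: le_int; [exact: (bmf_comp bv msum_pos)|exact: (bmf_comp bu msum_pos)|].
  by move=> p; rewrite /v ge_max u0// andbT gerBl.
have H3 : mgf_trunc F l t - mgf_trunc F g t - exp_gap l x0 <= \int[law F]_y v (pos y).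
  have b1 := bmf_comp bl mpos; have b2 := bmf_comp bg mpos.
  have b3 := bmf_comp bu mpos; have b4 := bmf_cst R (- exp_gap l x0).
  have -> : mgf_trunc F l t - mgf_trunc F g t - exp_gap l x0 =
      \int[law F]_y (u (pos y) - exp_gap l x0).
    rewrite [RHS](intD _ b3 b4) int_cst; congr (_ - _).
    rewrite -mgf_trunc_pos// -mgf_trunc_pos// -mulN1r -intZ//.
    by rewrite -intD//; exact: bmfZ.
  apply: le_int => [||y].
  - exact: bmfD.
  - exact: bmf_comp bv mpos.
  - by rewrite /v le_max lexx.
suff H4 : 2 * b * \int[law F]_y v (pos y) <= \int[pair_law F]_p v (sum_pos p).
  apply: le_trans H1; apply: le_trans H2; apply: le_trans H4.
  by rewrite ler_wpM2l// mulr_ge0.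
apply: le_int_tails.
- exact: (bmf_comp bv msum_pos).
- exact: (bmf_comp bv mpos).
- by rewrite mulr_ge0.
- by move=> p; rewrite /v le_max lexx orbT.
- by move=> y; rewrite /v le_max lexx orbT.
move=> r r0; set q := r + exp_gap l x0.
have vE s : 0 <= s -> (r < v s) = (q < exp_gap l (Num.min s t)).
  by move=> s0'; rewrite /v lt_max (ltNge r 0) r0 orbF uE ltrBrDr.
have [qt|qt] := leP (exp_gap l t) q.
  have N s : 0 <= s -> ~ r < v s.
    move=> s0'; rewrite vE//; apply/negP; rewrite -leNgt (le_trans _ qt)//.
    by rewrite exp_gap_le// w0//= ge_min lexx orbT.
  rewrite [X in pr (law F) X](_ : _ = set0) ?pr0 ?mulr0 ?pr_ge0//.
  by apply/seteqP; split => // y /= /N; apply.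
have [h] : exists2 h, h \in `[x0, t] & exp_gap l h = q.
  apply: IVT => //.
    apply: continuous_subspaceT => z.
    by apply: cvgB; apply: continuous_comp;
      [exact: mulrl_continuous|exact: continuous_expR|exact: mulrl_continuous|exact: continuous_expR].
  rewrite ge_min le_max (ltW qt) orbT andbT.
  by rewrite /q lerDr r0.
rewrite in_itv/= => /andP[x0h ht] hq.
have hlt : h < t.
  by move: ht; rewrite le_eqVlt => /predU1P[ht|//]; move: qt; rewrite -hq ht ltxx.
have h0 : 0 <= h by exact: le_trans x0h.
have vh s : 0 <= s -> (r < v s) = (h < s).
  move=> s0'; rewrite vE// -hq; have [hs|sh] := ltP h s.
    by rewrite exp_gap_lt// h0 lt_min hs hlt.
  apply/negbTE; rewrite -leNgt exp_gap_le// w0//=.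
  by rewrite ge_min sh.
have -> : [set y | r < v (pos y)] = [set y | h < y].
  by apply/seteqP; split => y /=; rewrite vh// lt_max (ltNge h 0) h0 orbF.
rewrite law_gt; apply: le_trans (Hb h x0h) _; rewrite tail_nconv2.
apply: pr_le; first exact: measurable_sum_gt.
  by apply: measurable_gtr; exact: (measurableT_comp bv.1 msum_pos).
move=> p /= hp; rewrite vh//; apply: lt_le_trans hp _.
by rewrite lerD// le_max lexx.
Qed.
End lower_limit.

(** * The lower limit of the convolution ratio *)

Section arithmetic.
Context {R : realFieldType}.
Implicit Types b m e d h p q w z : R.

Lemma gap_scale p q m e z : 0 < e -> q <= m -> 0 <= z - 1 ->
  (z - 1) * (2 * (m + 1)) <= e -> p <= z * q -> p - q < e.
Proof. by move=> e0 qm z1 ze pq; nra. Qed.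

Lemma gap_step p p' q q' m e z : 0 <= e -> q <= m -> q <= q' -> 0 <= z - 1 ->
  (z - 1) * (2 * (m + e)) <= e -> p' <= z * p -> p - q < e -> p' - q' <= 2 * e.
Proof.
move=> e0 qm qq z1 ze pp pq.
have : (z - 1) * p <= (z - 1) * (m + e) by rewrite ler_wpM2l//; lra.
lra.
Qed.

Lemma sqr_gap m w e : 0 <= w -> w <= m -> m - w <= e / (8 * (m + 1)) ->
  m ^+ 2 - w ^+ 2 <= e / 4.
Proof.
move=> w0 wm; have m1 : 0 < 8 * (m + 1) by lra.
rewrite ler_pdivlMr// => H.
have : (m - w) * (m + w) <= (m - w) * (2 * (m + 1)) by rewrite ler_wpM2l//; lra.
rewrite !expr2; lra.
Qed.

(** With [p = q + e] this is the comparison of [2 b e] with [(m + e)^2 - m^2], up to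
    errors of order [h^2]. *)
Lemma quadratic_gap b m h d p q w : m < b -> h = (b - m) / 4 -> 0 <= q -> q <= m ->
  h <= p - q -> p - q <= 2 * h ->
  2 * b * d <= h * (b - m) / 4 -> m ^+ 2 - w ^+ 2 <= h * (b - m) / 4 ->
  2 * b * (p - q - d) <= p ^+ 2 - w ^+ 2 -> False.
Proof.
move=> mb hE q0 qm; have h0 : 0 < h by rewrite hE; lra.
have : p = q + (p - q) by rewrite addrC subrK.
move: (p - q) => s -> hs s2 bd mw H.
have p2 : (q + s) ^+ 2 <= (m + s) ^+ 2 by rewrite ler_sqr ?nnegrE; lra.
have ss : s ^+ 2 <= s * (2 * h) by rewrite expr2 ler_wpM2l//; lra.
have H1 : 2 * (b - m) * s <= s * (2 * h) + h * (b - m) / 2.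
  by move: H p2; rewrite mulrBr sqrrD; lra.
have H2 : h * (b - m) <= s * (b - m) by rewrite ler_wpM2r//; lra.
have H3 : 0 < s * (b - m) by rewrite mulr_gt0//; lra.
by move: H1; rewrite {1}hE; lra.
Qed.

Lemma min_shift h (y t : R) : 0 <= h -> Num.min y (t + h) <= h + Num.min y t.
Proof. by rewrite /Num.min; do 2 case: ifPn; rewrite -?leNgt; lra. Qed.
End arithmetic.

Section convolution_constant.
Context {R : realType}.
Variables (F : df R) (g : R).
Hypotheses (g0 : 0 <= g) (LF : classLg g F).

Let cF : classF R F. Proof. by case: LF. Qed.

Lemma expR_small (e T : R) : 0 < e -> 0 <= T -> exists2 d, 0 < d <= 1 &
  expR (d * T) <= 1 + e.
Proof.
move=> e0 T0; have e1 : 0 < ln (1 + e) by rewrite ln_gt0// ltrDl.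
have T1 : 0 < T + 1 by rewrite ltr_wpDl.
have d0 : 0 < Num.min 1 (ln (1 + e) / (T + 1)) by rewrite lt_min ltr01 divr_gt0.
exists (Num.min 1 (ln (1 + e) / (T + 1))); first by rewrite d0 ge_min lexx.
rewrite -[leRHS]lnK ?posrE ?addr_gt0// ler_expR.
apply: (@le_trans _ _ (ln (1 + e) / (T + 1) * (T + 1))); last by rewrite divfK// gt_eqF.
apply: ler_pM => //; first exact: ltW.
  by rewrite ge_min lexx orbT.
by rewrite lerDl.
Qed.

(** Along an arithmetic progression the tail eventually decays more slowly than
    [exp (- l t)], by a geometric factor. *)
Lemma mgf_trunc_unbounded l T h B : g < l -> 0 < h ->
  exists k, B <= mgf_trunc F l (T + k%:R * h).
Proof.
move=> gl h0; have l0 : 0 <= l by rewrite (le_trans g0)// ltW.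
have low t : expR (l * t) * tail F t <= mgf_trunc F l t.
  have mgt : measurable [set y : R | t < y] by exact: measurable_gtr.
  have b := bmf_indic R mgt.
  rewrite -law_gt -int_indic// -intZ//; apply: le_int => [||y].
  - exact: bmfZ.
  - exact: bmf_exp_min.
  - rewrite indic_set /Num.min; have [ty|ty] := ltP t y.
      by rewrite ltNge (ltW ty) /= mulr1.
    by rewrite mulr0 expR_ge0.
pose c := (l - g) / 2 * h.
have c0 : 0 < c by rewrite !(mulr_gt0, divr_gt0)// subr_gt0.
have step : \forall x \near +oo, expR c * (expR (l * x) * tail F x) <=
    expR (l * (x + h)) * tail F (x + h).
  have lt : expR (c - l * h) < expR (- g * h).
    rewrite ltr_expR /c; have : 0 < (l - g) * h by rewrite mulr_gt0// subr_gt0.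
    nra.
  apply: filterS (cvgr_ge _ (LF.2 h) _ lt) => x.
  rewrite ler_pdivlMr ?tail_gt0// => H.
  have -> : expR c * (expR (l * x) * tail F x) =
      expR (l * (x + h)) * (expR (c - l * h) * tail F x).
    by rewrite !mulrA -!expRD; congr (expR _ * _); ring.
  by rewrite ler_wpM2l// expR_ge0.
have [M [_ HM]] := step.
pose t k : R := T + k%:R * h.
pose k0 := (Num.truncn (`|M - T| / h)).+1.
have Mt k : (k0 <= k)%N -> M < t k.
  move=> kk; rewrite -ltrBlDl (le_lt_trans (ler_norm _))// -ltr_pdivrMr//.
  by apply: (lt_le_trans (truncnS_gt _)); rewrite ler_nat.
pose a k := expR (l * t k) * tail F (t k).
have a0 k : 0 < a k by rewrite mulr_gt0 ?expR_gt0 ?tail_gt0.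
have aS j : expR (j%:R * c) * a k0 <= a (k0 + j)%N.
  elim: j => [|j IH]; first by rewrite mul0r expR0 mul1r addn0.
  have := HM _ (Mt (k0 + j)%N (leq_addr _ _)).
  have -> : t (k0 + j)%N + h = t (k0 + j).+1 by rewrite /t -natr1 mulrDl mul1r addrA.
  rewrite -/(a _) -/(a _) addnS; apply: le_trans.
  have -> : expR (j.+1%:R * c) = expR c * expR (j%:R * c).
    by rewrite -expRD -natr1 mulrDl mul1r addrC.
  by rewrite -mulrA ler_wpM2l// expR_ge0.
pose j := (Num.truncn (`|B| / a k0 / c)).+1.
exists (k0 + j)%N; apply: le_trans (low _); rewrite -/(t _) -/(a _).
apply: le_trans (aS j); rewrite -ler_pdivrMr//.
apply: (@le_trans _ _ (j%:R * c)).
  rewrite -ler_pdivrMr//; apply/ltW/(le_lt_trans _ (truncnS_gt _)).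
  by rewrite !ler_wpM2r ?invr_ge0 ?ler_norm// ltW.
by apply: le_trans (expR_ge1Dx _); rewrite lerDr.
Qed.

Lemma mgf_trunc_ge0 l t : 0 <= l -> 0 <= mgf_trunc F l t.
Proof.
move=> l0; rewrite -(int_cst (law F) 0); apply: le_int.
- exact: bmf_cst.
- exact: bmf_exp_min.
- by move=> y; exact: expR_ge0.
Qed.

Lemma mgf_trunc_perturb d t : 0 <= d ->
  mgf_trunc F (g + d) t <= expR (d * t) * mgf_trunc F g t.
Proof.
move=> d0; have gd0 : 0 <= g + d by rewrite addr_ge0.
rewrite /mgf_trunc -intZ; last exact: bmf_exp_min.
apply: le_int => [||y]; [exact: bmf_exp_min|by apply: bmfZ; exact: bmf_exp_min|].
rewrite -expRD ler_expR mulrDl addrC lerD2r ler_wpM2l//.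
by rewrite ge_min lexx orbT.
Qed.

Lemma mgf_trunc_step l t h : 0 <= l -> 0 <= h ->
  mgf_trunc F l (t + h) <= expR (h * l) * mgf_trunc F l t.
Proof.
move=> l0 h0; rewrite /mgf_trunc -intZ; last exact: bmf_exp_min.
apply: le_int => [||y]; [exact: bmf_exp_min|by apply: bmfZ; exact: bmf_exp_min|].
by rewrite -expRD ler_expR (mulrC h) -mulrDr ler_wpM2l// min_shift.
Qed.

Lemma exp_gap_perturb_le d x t : 0 <= d -> 0 <= x <= t ->
  exp_gap g (g + d) x <= expR (g * t) * (expR (d * t) - 1).
Proof.
move=> d0 /andP[x0 xt].
have -> : exp_gap g (g + d) x = expR (g * x) * (expR (d * x) - 1).
  by rewrite /exp_gap mulrBr mulr1 -expRD mulrDl.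
apply: ler_pM; [exact: expR_ge0|..].
- by rewrite subr_ge0 -[leLHS]expR0 ler_expR mulr_ge0.
- by rewrite ler_expR ler_wpM2l.
- by rewrite lerD2r ler_expR ler_wpM2l.
Qed.

(** If [2 b > 2 m], perturbing the exponent [g] slightly upwards raises the expectation
    over one summand by a small [e], and the one over the sum both by at most about
    [2 m e] and by at least about [2 b e]. *)
Lemma lower_limit_le m b :
  (forall K, mgf_trunc F g K <= m) ->
  (forall k, 0 < k -> exists2 K, 0 <= K & m - k <= mgf_trunc F g K) ->
  0 <= b -> (\forall x \near +oo, 2 * b * tail F x <= tail (nconv F 2) x) ->
  b <= m.
Proof.
move=> mM mE b0 [M0 [_ HM]]; rewrite leNgt; apply/negP => mb.
have m0 : 0 <= m by apply: le_trans (mM 0); exact: mgf_trunc_ge0.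
pose x0 := Num.max 0 (M0 + 1).
have x00 : 0 <= x0 by rewrite le_max lexx.
have Hb x : x0 <= x -> 2 * b * tail F x <= tail (nconv F 2) x.
  by rewrite ge_max => /andP[_ xM]; apply: HM; apply: lt_le_trans xM; rewrite ltrDl.
have th0 : 0 < b - m by rewrite subr_gt0.
pose h := (b - m) / 4; have h0 : 0 < h by rewrite divr_gt0.
have [K1 K10 HK1] : exists2 K, 0 <= K &
    m - h * (b - m) / (8 * (m + 1)) <= mgf_trunc F g K.
  by apply: mE; rewrite divr_gt0// !mulr_gt0// ltr_wpDl.
pose T := 2 * K1 + x0.
have T0 : 0 <= T by rewrite addr_ge0// mulr_ge0.
have x0T : 0 <= x0 <= T by rewrite x00 lerDr mulr_ge0.
(* The step [k] of the grid and the perturbation [d] of the exponent are chosen so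
   small that the gap grows by at most [h] per step, and starts below [h]. *)
have mh : 0 < 2 * (m + h) by rewrite mulr_gt0// ltr_wpDl.
have g1 : 0 <= g + 1 by rewrite addr_ge0.
have [k /andP[k0 _] Hk] := expR_small (divr_gt0 h0 mh) g1.
pose D1 := 2 * (m + 1); pose D2 := 8 * (b + 1) * expR (g * T) / (b - m).
have D10 : 0 < D1 by rewrite mulr_gt0// ltr_wpDl.
have D20 : 0 < D2 by rewrite divr_gt0// !mulr_gt0 ?expR_gt0// ltr_wpDl.
have [d /andP[d0 d1] Hd] := expR_small (divr_gt0 h0 (addr_gt0 D10 D20)) T0.
have dge0 : 0 <= d := ltW d0.
pose z := expR (d * T).
have z1 : 0 <= z - 1.
  by rewrite subr_ge0 -[leLHS]expR0 ler_expR mulr_ge0.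
have zD : (z - 1) * (D1 + D2) <= h.
  by rewrite -ler_pdivlMr ?addr_gt0// lerBlDl.
have gl : g < g + d by rewrite ltrDl.
have l0 : 0 <= g + d by rewrite addr_ge0.
pose e t := mgf_trunc F (g + d) t - mgf_trunc F g t.
have eT : e T < h.
  apply: (gap_scale h0 (mM T) z1 _ (mgf_trunc_perturb T dge0)).
  by apply: le_trans zD; rewrite ler_wpM2l// lerDl ltW.
have gapx0 : 2 * b * exp_gap g (g + d) x0 <= h * (b - m) / 4.
  have b2 : 0 <= 2 * b by rewrite mulr_ge0.
  apply: le_trans (ler_wpM2l b2 (exp_gap_perturb_le dge0 x0T)) _; rewrite -/z.
  have : (z - 1) * D2 <= h by apply: le_trans zD; rewrite ler_wpM2l// lerDr ltW.
  rewrite /D2 mulrA ler_pdivrMr//; have := mulr_ge0 (expR_ge0 (g * T)) z1.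
  move: (expR (g * T)) (z - 1) (h * (b - m)) => u v w; clear => uv H.
  have -> : 2 * b * (u * v) = v * (8 * (b + 1) * u) / 4 - 2 * (u * v) by field.
  lra.
pose t j : R := T + j%:R * k.
have tT j : T <= t j by rewrite lerDl mulr_ge0// ltW.
have [jB HjB] := mgf_trunc_unbounded T (m + h) gl k0.
have ex : exists j, h <= e (t j).
  by exists jB; rewrite /e lerBrDr addrC (le_trans _ HjB)// lerD2r mM.
case: (ex_minnP ex) => -[|j].
  by rewrite /t mul0r addr0 => H _; move: eT; rewrite ltNge H.
move=> ej jmin.
have ej' : e (t j) < h.
  by rewrite ltNge; apply/negP => /jmin; rewrite ltnn.
have tS : t j.+1 = t j + k by rewrite /t -natr1 mulrDl mul1r addrA.
have e2 : e (t j.+1) <= 2 * h.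
  have zk : expR (k * (g + d)) - 1 <= expR (k * (g + 1)) - 1.
    by rewrite lerD2r ler_expR ler_wpM2l ?(ltW k0)// lerD2l.
  apply: (gap_step (ltW h0) (mM (t j)) _ _ _ (p := mgf_trunc F (g + d) (t j))
    (z := expR (k * (g + d)))) => //.
  - by apply: mgf_trunc_nd => //; rewrite tS lerDl ltW.
  - by rewrite subr_ge0 -[leLHS]expR0 ler_expR mulr_ge0// ltW.
  - apply: le_trans (ler_wpM2r (ltW mh) zk) _.
    by rewrite -ler_pdivlMr// lerBlDl.
  - by rewrite tS; apply: mgf_trunc_step => //; exact: ltW.
have x0t : 0 <= x0 <= t j.+1.
  by case/andP: x0T => -> x0T; exact: le_trans (tT _).
have K1t : mgf_trunc F g K1 <= mgf_trunc F g (t j.+1 / 2).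
  apply: mgf_trunc_nd => //; rewrite ler_pdivlMr// mulrC.
  by apply: le_trans (tT j.+1); rewrite lerDl.
have m2 : m ^+ 2 - mgf_trunc F g (t j.+1 / 2) ^+ 2 <= h * (b - m) / 4.
  apply: (sqr_gap (mgf_trunc_ge0 _ g0) (mM _)).
  by rewrite lerBlDl -lerBlDr (le_trans HK1).
exact: (quadratic_gap mb (erefl h) (mgf_trunc_ge0 _ g0) (mM _) ej e2 gapx0 m2
  (mgf_trunc_ineq cF g0 gl b0 x0t Hb)).
Qed.
End convolution_constant.

(** * The constant of S(g) *)

Section classSg_single_jump.
Context {R : realType}.
Variables (F : df R) (g : R).
Hypotheses (g0 : 0 <= g) (SF : classSg g F).

(** The constant [c] is the supremum [s] of the truncated exponential moments: it is
    at least [s] because bounded truncations pass to the limit, and at most [s] by the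
    bound on the lower limit. *)
Lemma classSg_single_jump : single_jump F.
Proof.
move: SF => [LF [c c0 Hc]]; have [cF _] := LF.
have N K : no_jump F K x / tail F x @[x --> +oo] --> 2 * c - 2 * mgf_trunc F g K.
  apply: cvg_trans (cvgB Hc (nconv2_no_jump_ratio LF (K := K))).
  apply: near_eq_cvg; near=> x => /=.
  by rewrite -mulrBl opprB addrC subrK.
have mc K : mgf_trunc F g K <= c.
  have : 0 <= 2 * c - 2 * mgf_trunc F g K.
    apply: (cvgr_to_ge (@N K)); near=> x.
    by rewrite divr_ge0 ?no_jump_ge0 ?tail_ge0.
  lra.
pose s := sup (range (mgf_trunc F g)).
have hs : has_sup (range (mgf_trunc F g)).
  split; first by exists (mgf_trunc F g 0); exists 0.
  by exists c => _ [K _ <-].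
have ms K : mgf_trunc F g K <= s by apply: sup_upper_bound => //; exists K.
have se k : 0 < k -> exists2 K, 0 <= K & s - k <= mgf_trunc F g K.
  move=> k0; have [_ [K _ <-] HK] := sup_adherent k0 hs.
  exists (Num.max K 0); first by rewrite le_max lexx orbT.
  by apply: (le_trans (ltW HK)); apply: mgf_trunc_nd => //; rewrite le_max lexx.
have s0 : 0 <= s.
  apply: le_trans (ms 0); rewrite -(int_cst (law F) 0); apply: le_int.
  - exact: bmf_cst.
  - exact: bmf_exp_min.
  - by move=> y; exact: expR_ge0.
have cs : c <= s.
  rewrite leNgt; apply/negP => sc; pose b := (s + c) / 2.
  have bc : 2 * b < 2 * c by rewrite /b; lra.
  have b0 : 0 <= b by rewrite divr_ge0// addr_ge0// ltW.
  have : b <= s; last by rewrite /b; lra.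
  apply: (lower_limit_le g0 LF ms se b0).
  apply: filterS (cvgr_ge _ Hc _ bc) => x.
  by rewrite ler_pdivlMr// tail_gt0.
move=> e e0; have e4 : 0 < e / 4 by rewrite divr_gt0.
have [K K0 HK] := se _ e4; exists K => //.
have lt : 2 * c - 2 * mgf_trunc F g K < e by lra.
apply: filterS (cvgr_le _ (@N K) _ lt) => x.
by rewrite ler_pdivrMr// tail_gt0.
Unshelve. all: by end_near. Qed.
End classSg_single_jump.

(** * A light-tailed law in J *)

Section light_tailed_example.
Context {R : realType}.

(** An exponential tail with an integrable polynomial factor: the moment generating
    function is finite at 1, and the factor is of dominated variation. It equals 1
    at 0, so that the law has no atom there. *)
Definition decay (z : R) : R := 2 * expR (- z) / ((1 + z) * (2 + z)).

Lemma decay_gt0 z : 0 <= z -> 0 < decay z.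
Proof. by move=> z0; rewrite divr_gt0 ?mulr_gt0 ?expR_gt0//; lra. Qed.

Lemma decay_ni z w : 0 <= z -> z <= w -> decay w <= decay z.
Proof.
move=> z0 zw; rewrite /decay ler_pM ?mulr_ge0 ?invr_ge0 ?expR_ge0//; try lra.
- by rewrite mulr_ge0//; lra.
- by rewrite ler_pM2l// ler_expR lerN2.
- by rewrite lef_pV2 ?posrE ?mulr_gt0//; try lra; rewrite ler_pM//; lra.
Qed.

Lemma decay0 : decay 0 = 1.
Proof. by rewrite /decay oppr0 expR0 !addr0 mulr1 mul1r divff. Qed.

Lemma decay_le_exp z : 0 <= z -> decay z <= expR (- z).
Proof.
move=> z0; have d0 : 0 < (1 + z) * (2 + z) by rewrite mulr_gt0//; lra.
rewrite /decay ler_pdivrMr// mulrC ler_wpM2l ?expR_ge0//.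
have := sqr_ge0 z; rewrite expr2; lra.
Qed.

Definition light_df (x : R) : R := 1 - decay (Num.max x 0).

Let pos_ge0 x : 0 <= Num.max x 0 :> R. Proof. by rewrite le_max lexx orbT. Qed.

Lemma light_df_nd : nondecreasing light_df.
Proof.
move=> x y xy; rewrite /light_df lerD2l lerN2 decay_ni//.
by rewrite ge_max !le_max xy lexx orbT.
Qed.

Lemma light_df_continuous : continuous light_df.
Proof.
move=> x; have cp : (fun y : R => Num.max y 0) y @[y --> x] --> Num.max x 0.
  by apply: (@continuous_max R R id (cst 0) x) => //; exact: cvg_cst.
apply: cvgB; first exact: cvg_cst.
apply: cvgM.
  apply: cvgM; first exact: cvg_cst.
  by apply: continuous_cvg; [exact: continuous_expR|exact: cvgN].
apply: cvgV; first by rewrite gt_eqF// mulr_gt0//; have := pos_ge0 x; lra.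
by apply: cvgM; apply: cvgD => //; exact: cvg_cst.
Qed.

Lemma light_df_rc : right_continuous light_df.
Proof. by apply: right_continuousW; exact: light_df_continuous. Qed.

Lemma light_df_Ny : light_df @ -oo --> (0 : R).
Proof.
apply: cvg_near_cst; apply: filterS (nbhs_ninfty_le (num_real (0 : R))) => x x0.
by rewrite /light_df (max_idPr x0) decay0 subrr.
Qed.

Lemma light_df_y : light_df @ +oo --> (1 : R).
Proof.
rewrite -[X in _ --> X]subr0; apply: cvgB; first exact: cvg_cst.
apply: (squeeze_cvgr _ (cvg_cst (0 : R)) (@cvgr_expR R)).
apply: filterS (near_ge 0) => x x0.
by rewrite (max_idPl x0) (ltW (decay_gt0 x0)) decay_le_exp.
Qed.

HB.instance Definition _ := isCumulative.Build R _ R light_df light_df_nd light_df_rc.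
HB.instance Definition _ := isCumulativeBounded.Build R 0 1 light_df light_df_Ny light_df_y.

Definition light : df R := light_df.

Lemma tail_light x : tail light x = decay (Num.max x 0).
Proof. by rewrite /tail /light /= /light_df opprB addrC subrK. Qed.

Lemma tail_light_ge0 x : 0 <= x -> tail light x = decay x.
Proof. by move=> x0; rewrite tail_light (max_idPl x0). Qed.

Lemma light_classF : classF R light.
Proof.
split=> x; last by rewrite df_tail tail_light gtrBl decay_gt0.
by move=> x0; rewrite df_tail tail_light (max_idPr (ltW x0)) decay0 subrr.
Qed.

Definition partial_mgf (N n : nat) : R :=
  \int[law light]_y (expR (Num.min y n%:R) * \1_[set y | N%:R < y] y).

Let bmf_min n : bounded_measurable (fun y : R => expR (Num.min y n)).
Proof. by have := bmf_exp_min n (@ler01 R); under eq_fun do rewrite mul1r. Qed.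

Let mgt x : measurable [set y : R | x < y]. Proof. exact: measurable_gtr. Qed.

Let bmf_partial N n :
  bounded_measurable (fun y : R => expR (Num.min y n) * \1_[set y | N < y] y).
Proof. by apply: bmfM => //; exact: bmf_indic. Qed.

(** The polynomial factor of the tail makes the increments telescope. *)
Lemma partial_mgf_le N n : (N <= n)%N ->
  partial_mgf N n <= 2 * (expR 1 + 1) / (1 + N%:R).
Proof.
move=> Nn; rewrite -(subnK Nn) addnC; move: (n - N)%N => j {Nn n}.
have e1 : 1 <= expR (1 : R) by rewrite -[leLHS]expR0 ler_expR.
suff : partial_mgf N (N + j) <= 2 / (1 + N%:R) +
    2 * (expR 1 - 1) * ((1 + N%:R)^-1 - (1 + (N + j)%:R)^-1).
  move=> /le_trans; apply; have : 0 <= (1 + (N + j)%:R)^-1 :> R by rewrite invr_ge0 addr_ge0.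
  have : 0 <= (1 + N%:R)^-1 :> R by rewrite invr_ge0 addr_ge0.
  nra.
elim: j => [|j IH].
  rewrite addn0 subrr mulr0 addr0.
  apply: (@le_trans _ _ (expR N%:R * tail light N%:R)).
    rewrite -law_gt -int_indic// -intZ; last exact: bmf_indic.
    apply: le_int => [||y]; first exact: bmf_partial.
      by apply: bmfZ; exact: bmf_indic.
    rewrite indic_set; case: (N%:R < y); rewrite ?mulr0// !mulr1 ler_expR.
    by rewrite ge_min lexx orbT.
  rewrite tail_light_ge0// /decay mulrA mulrCA -expRD subrr expR0 mulr1.
  have N0 : 0 <= N%:R :> R by [].
  have d1 : 0 < 1 + N%:R :> R by lra.
  have d2 : 0 < 2 + N%:R :> R by lra.
  have d12 : 0 < (1 + N%:R) * (2 + N%:R) :> R by exact: mulr_gt0.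
  rewrite ler_wpM2l//; rewrite lef_pV2 ?posrE//.
  by rewrite ler_peMr ?(ltW d1)//; lra.
set n := (N + j)%N; rewrite addnS -/n in IH *.
have stp : partial_mgf N n.+1 <= partial_mgf N n +
    (expR n.+1%:R - expR n%:R) * tail light n%:R.
  rewrite -law_gt -int_indic// -intZ; last exact: bmf_indic.
  have b1 := bmfZ (expR n.+1%:R - expR n%:R) (bmf_indic R (mgt n%:R)).
  rewrite /partial_mgf -(intD _ (bmf_partial N%:R n%:R) b1).
  apply: le_int => [||y]; first exact: bmf_partial.
    by apply: bmfD => //; exact: bmf_partial.
  have nn1 : n%:R <= n.+1%:R :> R by rewrite ler_nat.
  have ee : expR n%:R <= expR n.+1%:R :> R by rewrite ler_expR.
  rewrite !indic_set; have [ny|yn] := ltP n%:R y.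
    have Ny : N%:R < y by apply: le_lt_trans ny; rewrite ler_nat leq_addr.
    rewrite Ny !mulr1 addrC subrK ler_expR.
    by rewrite ge_min lexx orbT.
  by rewrite mulr0 addr0 (min_idPl (le_trans yn nn1)).
apply: (le_trans stp); apply: le_trans (lerD IH (lexx _)) _.
have n0 : 0 <= n%:R :> R by [].
rewrite -addrA lerD2l tail_light_ge0// /decay.
have -> : expR n.+1%:R - expR n%:R = (expR 1 - 1) * expR n%:R :> R.
  by rewrite mulrBl mul1r -expRD nat1r.
have -> : (expR 1 - 1 : R) * expR n%:R * (2 * expR (- n%:R) / ((1 + n%:R) * (2 + n%:R)))
   = 2 * (expR 1 - 1) * ((1 + n%:R)^-1 - (1 + n.+1%:R)^-1) * (expR n%:R * expR (- n%:R)).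
  have nS : n.+1%:R = n%:R + 1 :> R by rewrite natr1.
  by rewrite nS; field; apply/andP; split; rewrite gt_eqF//; lra.
by rewrite -expRD subrr expR0 mulr1 -mulrDr addrA subrK.
Qed.
End light_tailed_example.

Section light_tailed_example_classes.
Context {R : realType}.

Let mgt (x : R) : measurable [set y : R | x < y]. Proof. exact: measurable_gtr. Qed.

Lemma decay_half (x : R) : 0 <= x ->
  (1 + x) * (2 + x) <= 4 * ((1 + x / 2) * (2 + x / 2)).
Proof. by move=> x0; nra. Qed.

(** Up to the constant 4 the tail behaves multiplicatively as long as the larger
    argument is at least [x / 2], since the polynomial factor then changes little. *)
Lemma tail_light_split (x y : R) : 0 <= y <= x / 2 ->
  tail light (x - y) <= 4 * expR y * tail light x.
Proof.
move=> /andP[y0 yx]; have x0 : 0 <= x by lra.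
rewrite !tail_light_ge0//; last by lra.
have d1 : 0 < (1 + (x - y)) * (2 + (x - y)) by rewrite mulr_gt0//; lra.
have d2 : 0 < (1 + x) * (2 + x) by rewrite mulr_gt0//; lra.
have d3 : (1 + x) * (2 + x) <= 4 * ((1 + (x - y)) * (2 + (x - y))).
  by apply: le_trans (decay_half x0) _; rewrite ler_pM2l// ler_pM//; lra.
have -> : decay (x - y) = 2 * (expR (- x) * expR y) / ((1 + (x - y)) * (2 + (x - y))).
  by rewrite /decay -expRD opprB addrC.
have -> : 4 * expR y * decay x = 2 * (expR (- x) * expR y) * (4 / ((1 + x) * (2 + x))).
  by rewrite /decay; field; apply/andP; split; rewrite gt_eqF//; lra.
rewrite ler_wpM2l ?mulr_ge0 ?expR_ge0//.
by rewrite ler_pdivlMr// mulrC ler_pdivrMr.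
Qed.

Let light_jump (K x : R) : set (R * R) := [set p | K < p.1 <= x / 2 /\ x < p.1 + p.2].

Lemma measurable_light_jump K x : measurable (light_jump K x).
Proof.
rewrite (_ : light_jump K x = ([set p | K < p.1] `&` ~` [set p | x / 2 < p.1]) `&`
    [set p | x < p.1 + p.2]).
  apply: measurableI; last exact: measurable_sum_gt.
  by apply: measurableI; [|apply: measurableC]; exact: measurable_fst_gt.
apply/seteqP; split => p.
  by move=> [/andP[Kp px] xp]; split => //; split => //=; apply/negP; rewrite -leNgt.
by move=> [[/= Kp /negP]]; rewrite -leNgt => px xp; split => //; rewrite Kp.
Qed.

Lemma pr_light_jump (N : nat) x : 0 <= x ->
  pr (pair_law light) (light_jump N%:R x) <=
  4 * (2 * (expR 1 + 1) / (1 + N%:R)) * tail light x.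
Proof.
move=> x0; pose n := maxn N (Num.truncn (x / 2)).+1.
have xn : x / 2 <= n%:R.
  by rewrite (le_trans (ltW (truncnS_gt _)))// ler_nat leq_maxr.
have mJ := measurable_light_jump N%:R x.
have bn : bounded_measurable
    (fun y : R => expR (Num.min y n%:R) * \1_[set y | N%:R < y] y).
  apply: bmfM; last exact: bmf_indic.
  by have := bmf_exp_min n%:R (@ler01 R); under eq_fun do rewrite mul1r.
rewrite pr_section//.
apply: (@le_trans _ _ (\int[law light]_y (4 * tail light x *
    (expR (Num.min y n%:R) * \1_[set y | N%:R < y] y)))).
  apply: le_int => [||y]; [exact: bmf_section|exact: bmfZ|].
  rewrite indic_set; have [/andP[Ny yx]|Nyx] := boolP (N%:R < y <= x / 2).
    rewrite Ny mulr1 (min_idPl (le_trans yx xn)).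
    rewrite -mulrA (mulrC (tail _ _)) mulrA.
    have y0 : 0 <= y <= x / 2 by rewrite yx (le_trans _ (ltW Ny)).
    apply: le_trans (tail_light_split y0).
    rewrite -law_gt; apply: pr_le => //; first exact: measurable_section mJ.
    by move=> z [_ /=]; rewrite ltrBlDl.
  rewrite [X in pr _ X](_ : _ = set0) ?pr0.
    by rewrite !mulr_ge0 ?expR_ge0 ?tail_ge0.
  by apply/seteqP; split => // z [/= yx]; rewrite yx in Nyx.
rewrite intZ// -/(partial_mgf N n) [leRHS]mulrAC ler_wpM2l ?mulr_ge0 ?tail_ge0//.
by apply: partial_mgf_le; exact: leq_maxl.
Qed.

(** If both summands exceed [x / 2] the polynomial factor is squared, which makes
    it negligible. *)
Lemma tail_light_sqr_half e : 0 < e ->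
  \forall x \near +oo, tail (@light R) (x / 2) ^+ 2 <= e * tail light x.
Proof.
move=> e0; apply: filterS2 (near_ge 0) (near_ge (16 / e)) => x x0 xe.
rewrite !tail_light_ge0//; last by lra.
have d1 : 0 < (1 + x / 2) * (2 + x / 2) by rewrite mulr_gt0//; lra.
have d2 : 0 < (1 + x) * (2 + x) by rewrite mulr_gt0//; lra.
have -> : decay (x / 2) ^+ 2 = 4 * expR (- x) / ((1 + x / 2) * (2 + x / 2)) ^+ 2.
  have -> : expR (- x) = expR (- (x / 2)) ^+ 2.
    by rewrite expr2 -expRD; congr expR; lra.
  by rewrite /decay; field; apply/andP; split; rewrite gt_eqF//; lra.
have -> : e * decay x = 4 * expR (- x) * (e / 2 / ((1 + x) * (2 + x))).
  by rewrite /decay; field; apply/andP; split; rewrite gt_eqF//; lra.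
rewrite ler_wpM2l ?mulr_ge0 ?expR_ge0// ler_pdivlMr// mulrC ler_pdivrMr ?exprn_gt0//.
have := decay_half x0; set D := (1 + x / 2) * (2 + x / 2) in d1 *.
have D8 : 8 <= e * D.
  move: xe; rewrite ler_pdivrMr// /D => xe; nra.
move=> /le_trans; apply; rewrite expr2; nra.
Qed.

(** Either the smaller summand is at most [x / 2] but exceeds [N], which costs a tail
    of the convergent exponential moment, or both summands exceed [x / 2]. *)
Lemma light_single_jump : single_jump (@light R).
Proof.
move=> e e0; have e4 : 0 < e / 4 by rewrite divr_gt0.
pose A : R := 4 * (2 * (expR 1 + 1)).
have A0 : 0 < A by rewrite !mulr_gt0// addr_gt0// expR_gt0.
pose N := (Num.truncn (A / (e / 4))).+1.
have AN : 4 * (2 * (expR 1 + 1) / (1 + N%:R)) <= e / 4 :> R.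
  rewrite mulrA -/A ler_pdivrMr ?ltr_pwDl// mulrC -ler_pdivrMr//.
  by rewrite (le_trans (ltW (truncnS_gt _)))// lerDr.
exists N%:R => //.
apply: filterS2 (tail_light_sqr_half e4) (near_ge 0) => x Hx x0.
have mJ := measurable_light_jump N%:R x.
pose S : set (R * R) := [set p | light_jump N%:R x (p.2, p.1)].
have mS : measurable S.
  have ms : measurable_fun setT (fun p : R * R => (p.2, p.1)).
    by apply: measurable_fun_pair; [exact: measurable_snd|exact: measurable_fst].
  by have := ms measurableT _ mJ; rewrite setTI.
pose B : set (R * R) := [set p | x / 2 < p.1 /\ x / 2 < p.2].
have mB : measurable B.
  by apply: measurableI; [exact: measurable_fst_gt|exact: measurable_snd_gt].
have HJ : pr (pair_law light) (light_jump N%:R x) <= e / 4 * tail light x.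
  by apply: le_trans (pr_light_jump N x0) _; rewrite ler_wpM2r ?tail_ge0.
have HS : pr (pair_law light) S = pr (pair_law light) (light_jump N%:R x).
  exact: pr_swap.
apply: (@le_trans _ _ (pr (pair_law light) (light_jump N%:R x `|` S) + pr (pair_law light) B)).
  apply: pr_leD => //; [exact: measurable_no_jump_set|exact: measurableU|].
  move=> p [p1 p2 xp].
  have gt1 : N%:R < p.1 by move: p2 xp; clear; lra.
  have gt2 : N%:R < p.2 by move: p1 xp; clear; lra.
  have [h1|h1] := leP p.1 (x / 2); first by left; left; rewrite /light_jump /= gt1 h1.
  have [h2|h2] := leP p.2 (x / 2); last by right.
  by left; right; rewrite /S /light_jump /= gt2 h2 addrC.
have : pr (pair_law light) (light_jump N%:R x `|` S) <= pr (pair_law light) (light_jump N%:R x) + pr (pair_law light) S.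
  by apply: pr_leD => //; exact: measurableU.
rewrite HS /B pair_both_gt; move: HJ Hx.
have := mulr_ge0 (ltW e0) (tail_ge0 (@light R) x).
move: (pr _ (light_jump _ x)) (pr _ (_ `|` S)) (tail light (x / 2) ^+ 2) (tail light x).
by clear => *; lra.
Qed.

(** The truncated exponential moments of order 1 are bounded, hence so is the
    exponential moment itself, by monotone convergence. *)
Lemma light_not_classK : ~ classK R (@light R).
Proof.
move=> [_ /(_ 1 ltr01)]; apply/eqP; rewrite -ltey.
have me : measurable_fun setT (fun y : R => (expR y)%:E).
  by apply/measurable_EFinP; exact: measurable_expR.
have bn n : bounded_measurable (fun y : R => expR (Num.min y n)).
  by have := bmf_exp_min n (@ler01 R); under eq_fun do rewrite mul1r.
pose C : R := 1 + 2 * (expR 1 + 1).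
have Hn n : \int[law light]_y expR (Num.min (y : R) n%:R) <= C.
  have b1 := bmfM (bn n%:R) (bmf_indic R (mgt 0%:R)).
  apply: (@le_trans _ _ (\int[law light]_y (1 + expR (Num.min y n%:R) * \1_[set y | 0%:R < y] y))).
    apply: le_int => // [|y]; first by apply: bmfD => //; exact: bmf_cst.
    rewrite indic_set; have [y0|y0] := ltP 0%:R y; first by rewrite mulr1 lerDr.
    by rewrite mulr0 addr0 -expR0 ler_expR ge_min y0.
  rewrite intD//; last exact: bmf_cst.
  rewrite int_cst lerD2l -/(partial_mgf 0 n) (le_trans (partial_mgf_le (leq0n n)))//.
  by rewrite addr0 divr1.
apply: (@le_lt_trans _ _ C%:E); last exact: ltry.
have E : (\int[lebesgue_stieltjes_measure (@light R)]_(x in `[0%R, +oo[) (expR (1 * x))%:E <=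
    \int[law (@light R)]_y (expR y)%:E)%E.
  have -> : (\int[law (@light R)]_y (expR y)%:E)%E =
      (\int[lebesgue_stieltjes_measure (@light R)]_y (expR y)%:E)%E.
    exact: integral_law.
  under [leLHS]eq_integral do rewrite mul1r.
  exact: ge0_subset_integral.
apply: (le_trans E).
pose f n (y : R) := (expR (Num.min y n%:R))%:E.
have mf n : measurable_fun setT (f n) by apply/measurable_EFinP; case: (bn n%:R).
have fnd y : {homo f^~ y : n m / (n <= m)%N >-> (n <= m)%E}.
  move=> n m nm; rewrite /f lee_fin ler_expR le_min !ge_min lexx/=.
  by rewrite ler_nat nm orbT.
have -> : (\int[law (@light R)]_y (expR y)%:E)%E =
    (\int[law (@light R)]_y limn (f^~ y))%E.
  apply: eq_integral => y _; apply/esym/cvg_lim => //.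
  apply: cvg_near_cst; exists (Num.truncn y).+1 => // n /= yn.
  rewrite /f (min_idPl _)//; apply: (le_trans (ltW (truncnS_gt y))).
  by rewrite ler_nat.
rewrite monotone_convergence//; last first.
  by move=> n y _; rewrite lee_fin expR_ge0.
apply: lime_le.
  apply: ereal_nondecreasing_is_cvgn => n m nm; apply: ge0_le_integral => //.
  - by move=> y _; rewrite lee_fin expR_ge0.
  - by move=> y _; exact: fnd.
by apply: nearW => n; rewrite -int_EFin// lee_fin.
Qed.
End light_tailed_example_classes.

Theorem proposition5 (R : realType) :
  [/\ (*a*) classJ R `<=` classOS R,
      (*b*) classJ R `&` classL R = classS R,
      (*b'*) forall gamma : R, 0 < gamma ->
        classJ R `&` classLg gamma = classSg gamma,
      (*c*) classD R `<=` classJ R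
    & (*d*) ~ (classJ R `<=` classK R)].
Proof.
split.
- move=> F JF; apply: single_jump_classOS; first by case: JF.
  exact: classJ_single_jump.
- apply/seteqP; split => F.
    move=> [JF LF]; apply: single_jump_classS => //; first by case: JF.
    exact: classJ_single_jump.
  move=> SF; have [cF _] := SF; split; last exact: classS_classL.
  by apply: single_jump_classJ => //; exact: classS_single_jump.
- move=> g /ltW g0; apply/seteqP; split => F.
    by move=> [JF LF]; apply: single_jump_classSg => //; exact: classJ_single_jump.
  move=> SF; have [LF _] := SF; split => //.
  apply: single_jump_classJ; first by case: LF.
  exact: classSg_single_jump g0 SF.
- move=> F DF; apply: single_jump_classJ; first by case: DF.
  exact: classD_single_jump.
- move=> /(_ _ (single_jump_classJ (@light_classF R) light_single_jump)).
  exact: light_not_classK.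
Qed.
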